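(* Let $G$ be a compact connected Lie group and $F$ a left-invariant Finsler metric on $G$. Then $F$ has at least one homogeneous geodesic. If, in particular, $G$ is also semi-simple and of rank $\geq 2$, then $F$ has infinitely many homogeneous geodesics.
   Context: A Finsler metric on a smooth manifold $M$ is a continuous function $F:TM\to[0,\infty)$, smooth on $TM\setminus\{0\}$, positively homogeneous of degree one ($F(tu)=tF(u)$ for $t\ge 0$; not necessarily reversible), such that for every $y\in T_xM\setminus\{0\}$ the symmetric bilinear form $g_y(u,v)=\frac12\frac{\partial^2}{\partial s\partial t}F^2(x,y+su+tv)\big|_{s=t=0}$ on $T_xM$ is positive definite. Geodesics are the Finslerian (constant speed) geodesics, i.e. curves $\sigma$ with velocity $T=\dot\sigma$ satisfying $D_TT=0$ with reference vector $T$ for the Chern connection. $F$ is left-invariant if the differentials of all left translations of $G$ preserve $F$. $G$ acts on itself by left translations, with origin the identity $e$. A homogeneous geodesic through the origin is a geodesic which is an orbit of a one-parameter subgroup, that is, of the form $\gamma(t)=\exp(tZ)(e)=\exp(tZ)$, $t\in\mathbb R$, with $Z$ a nonzero vector of the Lie algebra $\mathfrak g$ of $G$. *)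

(* Defs.v *)
From HB Require Import structures.
From mathcomp Require Import all_boot all_order all_algebra.
From mathcomp Require Import all_classical all_reals all_analysis.
Import Order.TTheory GRing.Theory Num.Theory.
Import numFieldNormedType.Exports.

Set Implicit Arguments.
Unset Strict Implicit.
Unset Printing Implicit Defensive.

Local Open Scope classical_set_scope.
Local Open Scope ring_scope.

(* Joint interface only; continuity of the operations is part of
   [is_lie_group] below. *)
#[short(type="topGroupType")]
HB.structure Definition TopologicalGroup := {G of Topological G & Group G}.

Section Smoothness.
Variables (R : realType) (V W : normedModType R).

(* Meant for open U in a finite-dimensional V: f is C^(k+1) iff it is
   continuous and every directional derivative exists and is C^k. *)
Fixpoint Ck_on (k : nat) (U : set V) (f : V -> W) : Prop :=
  (forall x, U x -> {for x, continuous f}) /\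
  (if k is k'.+1 then
     forall v, (forall x, U x -> derivable f x v) /\
               Ck_on k' U (fun x => 'D_v f x)
   else True).

Definition smooth_on (U : set V) (f : V -> W) := forall k, Ck_on k U f.

End Smoothness.

Section Manifolds.
Variables (R : realType) (n : nat) (M : topologicalType).

(* The values of cmap outside cdom and of cinv outside [cimg] are junk. *)
Record chart := Chart {
  cdom : set M;
  cmap : M -> 'rV[R]_n;
  cinv : 'rV[R]_n -> M;
  cdom_open : open cdom;
  cimg_open : open (cmap @` cdom);
  cmapK : forall p, cdom p -> cinv (cmap p) = p;
  cmap_continuous : forall p, cdom p -> {for p, continuous cmap};
  cinv_continuous : forall x, (cmap @` cdom) x -> {for x, continuous cinv}
}.

Definition cimg (a : chart) : set 'rV[R]_n := cmap a @` cdom a.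

(* A preferred chart is chosen around each point p; the tangent space T_pM
   is then modelled as 'rV_n, a vector being given by its components in the
   chart [chart_at p]. *)
Record atlas := Atlas {
  charts : set chart;
  chart_at : M -> chart;
  chart_at_charts : forall p, charts (chart_at p);
  chart_at_dom : forall p, cdom (chart_at p) p;
  charts_compatible : forall a b, charts a -> charts b ->
    smooth_on (cimg a `&` cinv a @^-1` cdom b) (cmap b \o cinv a)
}.

End Manifolds.

Section MapsIntoManifold.
Variables (R : realType) (n : nat) (M : topologicalType) (A : atlas R n M).

Definition smooth_map (V : normedModType R) (f : V -> M) :=
  continuous f /\
  forall a, charts A a -> smooth_on (f @^-1` cdom a) (cmap a \o f).

(* Element of the tangent space at s t. *)
Definition velocity (s : R -> M) (t : R) : 'rV[R]_n :=
  derive1 (cmap (chart_at A (s t)) \o s) t.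

(* Differential at p of f : M -> M, from the tangent space at p to the one
   at f p. *)
Definition tdiff (f : M -> M) (p : M) (v : 'rV[R]_n) : 'rV[R]_n :=
  let a := chart_at A p in
  let b := chart_at A (f p) in
  'D_v (cmap b \o f \o cinv a) (cmap a p).

End MapsIntoManifold.

(* g_y(u,v) for a function N on a vector space (in use, N = F(x,.)). *)
Definition fundamental_form (R : realType) (V : normedModType R)
    (N : V -> R) (y u v : V) : R :=
  2^-1 * derive1 (fun s : R =>
           derive1 (fun t : R => N (y + s *: u + t *: v) ^+ 2) 0) 0.

(* The Chern connection of a function L(x,y) on an open subset of
   R^n x (R^n minus 0), y being the reference vector. *)
Section ChernConnection.
Variables (R : realType) (n : nat) (L : 'rV[R]_n -> 'rV[R]_n -> R).

Local Notation V := 'rV[R]_n.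
Local Notation "'e_ i" := (delta_mx 0 i : V) (at level 8, i at level 2).

Definition dx (k : 'I_n) (h : V -> V -> R) (x y : V) : R :=
  'D_('e_ k) (fun x' => h x' y) x.

Definition dy (k : 'I_n) (h : V -> V -> R) (x y : V) : R :=
  'D_('e_ k) (fun y' => h x y') y.

Definition metric (i j : 'I_n) (x y : V) : R :=
  fundamental_form (L x) y ('e_ i) ('e_ j).

Definition metric_inv (i j : 'I_n) (x y : V) : R :=
  invmx (\matrix_(k, l) metric k l x y) i j.

(* gamma^i_jk *)
Definition formal_christoffel (i j k : 'I_n) (x y : V) : R :=
  2^-1 * \sum_s metric_inv i s x y *
    (dx k (metric s j) x y - dx s (metric j k) x y + dx j (metric k s) x y).

(* C^i_jk, where C_ijk = (1/4) d^3(L^2)/dy^i dy^j dy^k *)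
Definition cartan (i j k : 'I_n) (x y : V) : R :=
  \sum_s metric_inv i s x y * (2^-1 * dy k (metric s j) x y).

(* N^i_j = gamma^i_jk y^k - C^i_jk gamma^k_rs y^r y^s *)
Definition nonlinear_connection (i j : 'I_n) (x y : V) : R :=
  \sum_k formal_christoffel i j k x y * y 0 k -
  \sum_k \sum_r \sum_s
    cartan i j k x y * formal_christoffel k r s x y * y 0 r * y 0 s.

(* delta/delta x^k = d/dx^k - N^m_k d/dy^m *)
Definition horizontal (k : 'I_n) (h : V -> V -> R) (x y : V) : R :=
  dx k h x y - \sum_m nonlinear_connection m k x y * dy m h x y.

(* Gamma^i_jk *)
Definition chern (i j k : 'I_n) (x y : V) : R :=
  2^-1 * \sum_s metric_inv i s x y *
    (horizontal k (metric s j) x y - horizontal s (metric j k) x y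
     + horizontal j (metric k s) x y).

(* D_T T, with reference vector T = x', along the curve x *)
Definition covariant_acceleration (x : R -> V) (t : R) : V :=
  \row_i (derive1n 2 x t 0 i +
          \sum_j \sum_k chern i j k (x t) (derive1 x t) *
                        derive1 x t 0 j * derive1 x t 0 k).

End ChernConnection.

Section Finsler.
Variables (R : realType) (n : nat) (M : topologicalType) (A : atlas R n M).

(* F p v is the value at the tangent vector v at p, given by its components
   in [chart_at A p]; [local_expr F a] is the expression of F in the
   coordinates (x,y) on TM induced by the chart a. *)
Definition local_expr (F : M -> 'rV[R]_n -> R) (a : chart R n M)
    (x y : 'rV[R]_n) : R :=
  let p := cinv a x in F p ('D_y (cmap (chart_at A p) \o cinv a) x).

Record is_finsler (F : M -> 'rV[R]_n -> R) : Prop := IsFinsler {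
  finsler_ge0 : forall p v, 0 <= F p v;
  finsler_continuous : forall a, charts A a ->
    forall z : 'rV[R]_n * 'rV[R]_n, cimg a z.1 ->
    {for z, continuous (fun z => local_expr F a z.1 z.2 : R)};
  finsler_smooth : forall a, charts A a ->
    @smooth_on R ('rV[R]_n * 'rV[R]_n)%type R
      [set z | cimg a z.1 /\ z.2 != 0]
      (fun z => local_expr F a z.1 z.2);
  finsler_homogeneous : forall p v (t : R), 0 <= t -> F p (t *: v) = t * F p v;
  finsler_pos_def : forall p y, y != 0 -> forall u, u != 0 ->
    0 < fundamental_form (F p) y u u
}.

Definition is_geodesic (F : M -> 'rV[R]_n -> R) (s : R -> M) :=
  [/\ smooth_map A s,
      forall t, velocity A s t != 0 &
      forall a, charts A a -> forall t, cdom a (s t) ->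
        covariant_acceleration (local_expr F a) (cmap a \o s) t = 0].

End Finsler.

Section LieGroups.
Variables (R : realType) (n : nat) (G : topGroupType) (A : atlas R n G).

Record is_lie_group : Prop := IsLieGroup {
  lie_hausdorff : hausdorff_space G;
  lie_second_countable : @second_countable G;
  lie_mul_continuous : continuous (fun z : G * G => (z.1 * z.2)%g);
  lie_inv_continuous : continuous (fun g : G => g^-1%g);
  lie_mul_smooth : forall a b c, charts A a -> charts A b -> charts A c ->
    @smooth_on R ('rV[R]_n * 'rV[R]_n)%type 'rV[R]_n
      [set z | [/\ cimg a z.1, cimg b z.2 &
                   cdom c (cinv a z.1 * cinv b z.2)%g]]
      (fun z => cmap c (cinv a z.1 * cinv b z.2)%g);
  lie_inv_smooth : forall a b, charts A a -> charts A b ->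
    smooth_on [set x | cimg a x /\ cdom b ((cinv a x)^-1)%g]
      (fun x => cmap b ((cinv a x)^-1)%g)
}.

(* The left-invariant vector field with value X at the identity, in the
   coordinates of the chart around the identity: d(L_g)_e X for g = cinv x. *)
Definition left_field (X x : 'rV[R]_n) : 'rV[R]_n :=
  let c := chart_at A 1%g in
  'D_X (fun y => cmap c (cinv c x * cinv c y)%g) (cmap c 1%g).

(* Value at the identity of the commutator of left-invariant vector fields:
   [X,Y]^i = X^j d_j Y^i - Y^j d_j X^i. *)
Definition lie_bracket (X Y : 'rV[R]_n) : 'rV[R]_n :=
  let x0 := cmap (chart_at A 1%g) 1%g in
  'D_X (left_field Y) x0 - 'D_Y (left_field X) x0.

Definition killing_form (X Y : 'rV[R]_n) : R :=
  \tr (lin1_mx (fun Z => lie_bracket X (lie_bracket Y Z))).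

Definition semisimple :=
  forall X, (forall Y, killing_form X Y = 0) -> X = 0.

(* T is a k-dimensional toral subgroup, i.e. the image of an injective smooth
   homomorphism from R^k / Z^k. *)
Definition is_torus (k : nat) (T : set G) :=
  exists theta : 'rV[R]_k -> G,
    [/\ smooth_map A theta,
        forall x y, theta (x + y) = (theta x * theta y)%g,
        forall x, theta x = 1%g <-> (forall i, x 0 i \is a Num.int) &
        T = range theta].

Definition is_maximal_torus (k : nat) (T : set G) :=
  is_torus k T /\
  forall k' T', is_torus k' T' -> T `<=` T' -> T' = T.

(* r is the rank of G: the dimension of a maximal torus. *)
Definition has_rank (r : nat) := exists T, is_maximal_torus r T.

(* c is the one-parameter subgroup t |-> exp(tZ). *)
Definition is_one_parameter_subgroup (Z : 'rV[R]_n) (c : R -> G) :=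
  [/\ smooth_map A c,
      forall s t, c (s + t) = (c s * c t)%g &
      velocity A c 0 = Z].

Definition left_invariant (F : G -> 'rV[R]_n -> R) :=
  forall g p v, F (g * p)%g (tdiff A (fun q => (g * q)%g) p v) = F p v.

Definition is_homogeneous_geodesic (F : G -> 'rV[R]_n -> R) (c : R -> G) :=
  is_geodesic A F c /\
  exists2 Z, Z != 0 & is_one_parameter_subgroup Z c.

End LieGroups.

(* Main.v *)
(* Let c be a one-parameter subgroup with velocity Z.  The right-invariant field
   xi generating the left multiplications by c(t) has F-length
   p |-> F(Ad(p^-1) Z), a continuous function on the compact group G; it attains
   its maximum, and conjugating c moves the maximum to the identity.  Then c is
   a geodesic.  In a chart, write Q = F^2 and x(t) = c(t).  The function
   y |-> Q(y, xi(y)) is critical along x, so that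
     Q_x V + Q_y (Dxi V) = 0.
   The flow of xi consists of left translations, hence preserves Q, so the
   momentum Q_y(x, x') is constant on vectors carried along by this flow:
     (d/dt Q_y) V + Q_y (Dxi V) = 0.
   Together these are the Euler-Lagrange equations of Q, and by homogeneity the
   Cartan and nonlinear-connection terms cancel in Gamma^i_jk y^j y^k, so that
   Euler-Lagrange is D_T T = 0.

   For every X there is a one-parameter subgroup with velocity X: the limit along
   an ultrafilter of t |-> h_k^floor(k t), where h_k tends to the identity as the
   point with coordinates X / k.

   If the rank is at least 2, a maximal torus contains one-parameter subgroups
   c_i with velocity u + i v (v nonzero) whose kernel is the integers.  The
   geodesic found from c_i is conjugate to c_i and has velocity Z_i with
   F(Z_i) >= F(u + i v), which tends to infinity, while two such geodesics with
   the same range have opposite or equal velocities; hence each range occurs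
   only for finitely many i. *)

Require Import Defs.
From HB Require Import structures.
From mathcomp Require Import all_boot all_order all_algebra.
From mathcomp Require Import all_classical all_reals all_analysis.
From mathcomp Require Import ring lra.
Import Order.TTheory GRing.Theory Num.Theory.
Import numFieldNormedType.Exports.
Local Open Scope classical_set_scope.
Local Open Scope ring_scope.

Set Implicit Arguments.
Unset Strict Implicit.
Unset Printing Implicit Defensive.

(** * Derivatives along lines and the mean value theorem *)

(** Smoothness is given through iterated directional derivatives only, so the differentiability that
    the chain rule needs has to be won from continuous partial derivatives. What is proved is strict
    differentiability: the error is small relative to the increment, uniformly in the base point.
    This uniformity pays again in the group, where right multiplication by a small element is, in a
    chart, addition of a small vector up to a small relative error at every point near the identity.
    The errors of many small factors therefore add up linearly, and this replaces flows and the
    exponential map: limits of powers exist by compactness, are differentiable at 0 by the estimate,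
    and are smooth because the homomorphism law makes them solve an ordinary differential equation.

    Geodesics are counted by their ranges, so parametrisations must be recovered from ranges. This
    is why circle subgroups with kernel exactly the integers are used: for two of them with the same
    range, each velocity is an integer multiple of the other. Conjugation preserves the kernel, so
    the property survives the passage to the maximiser. *)

Section Lines.
Variables (R : realType) (W : normedModType R).

(** A directional derivative only sees a line. Functions on different spaces that agree along two
    parametrised lines thus have the same difference quotients, so translations, slices and passages
    to the real line need no chain rule. *)
Lemma same_line_quotient (V V' : normedModType R) (f : V -> W) (g : V' -> W)
    x v y w : (forall h : R, f (h *: v + x) = g (h *: w + y)) ->
  (fun h : R => h^-1 *: ((f \o shift x) (h *: v) - f x)) =
  (fun h => h^-1 *: ((g \o shift y) (h *: w) - g y)).
Proof.
move=> fg; have fg0 : f x = g y by have := fg 0; rewrite !scale0r !add0r.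
by apply/funext => h /=; rewrite fg fg0.
Qed.

Lemma is_derive_same_line (V V' : normedModType R) (f : V -> W) (g : V' -> W)
    x v y w df : (forall h : R, f (h *: v + x) = g (h *: w + y)) ->
  is_derive x v f df <-> is_derive y w g df.
Proof.
move=> /same_line_quotient E.
by split=> -[d e]; (split; [rewrite /derivable|rewrite /derive]); rewrite ?E // -E.
Qed.

Lemma derive_same_line (V V' : normedModType R) (f : V -> W) (g : V' -> W)
    x v y w : (forall h : R, f (h *: v + x) = g (h *: w + y)) ->
  'D_v f x = 'D_w g y.
Proof. by move=> /same_line_quotient E; rewrite /derive E. Qed.

Variable V : normedModType R.
Implicit Types (f : V -> W) (x y v w : V).

Lemma is_derive_translate f x v w df :
  is_derive (x + w) v f df -> is_derive x v (fun y => f (y + w)) df.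
Proof. by apply: (is_derive_same_line _ _).1 => h; rewrite addrA. Qed.

Lemma is_derive_line f x v (s : R) df :
  is_derive (x + s *: v) v f df -> is_derive s 1 (fun t : R => f (x + t *: v)) df.
Proof.
by apply: (is_derive_same_line _ _).1 => h; rewrite [h *: 1]mulr1 scalerDl addrCA.
Qed.

End Lines.

Section MeanValue.
Variables (R : realType) (V : normedModType R).
Implicit Types (f : V -> R) (x y v w : V).

Lemma MVT_line f x v (t : R) :
  (forall s : R, `|s| <= `|t| -> derivable f (x + s *: v) v) ->
  exists2 s : R, `|s| <= `|t| & f (x + t *: v) - f x = 'D_v f (x + s *: v) * t.
Proof.
move=> df.
have dl (s : R) : `|s| <= `|t| ->
    is_derive s 1 (fun t : R => f (x + t *: v)) ('D_v f (x + s *: v)).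
  by move=> /df /derivableP; apply: is_derive_line.
(* The one-variable theorem wants ordered endpoints; the sign of [t] decides below between the
   segments from 0 to [t] and from [t] to 0. *)
have mvt (a b : R) : a <= b -> (forall s, s \in `[a, b] -> `|s| <= `|t|) ->
  exists2 s, s \in `[a, b] & f (x + b *: v) - f (x + a *: v) = 'D_v f (x + s *: v) * (b - a).
  move=> ab abt.
  apply: (@MVT_segment _ (fun t => f (x + t *: v)) (fun s => 'D_v f (x + s *: v)) a b ab).
    by move=> s sab; apply/dl/abt; apply: subset_itv_oo_cc.
  by apply: derivable_within_continuous => s /abt /dl[].
have [t0|t0] := leP 0 t.
  have [] := mvt 0 t t0.
    by move=> s; rewrite in_itv /= => /andP[s0 st]; rewrite !ger0_norm.
  move=> s sab; rewrite scale0r addr0 subr0 => E; exists s => //.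
  by move: sab; rewrite in_itv /= => /andP[s0 st]; rewrite !ger0_norm.
have [] := mvt t 0 (ltW t0).
  by move=> s; rewrite in_itv /= => /andP[s0 st]; rewrite !ler0_norm ?lerN2// ltW.
move=> s sab; rewrite scale0r addr0 sub0r => E; exists s.
  by move: sab; rewrite in_itv /= => /andP[s0 st]; rewrite !ler0_norm ?lerN2// ltW.
by rewrite -[LHS]opprK opprB E mulrN opprK.
Qed.

End MeanValue.

(** * Strict differentiability of C^1 functions *)

Section Differentiability.
Variables (R : realType) (V : normedModType R).
Implicit Types (f : V -> R) (x y v w : V).

(** A finite resolution of the identity by continuous linear forms. In this form finite dimension
    passes to products, where tangent coordinates (x, y) and the group law in charts live. *)
Definition fin_dim := exists (I : finType) (e : I -> V) (p : I -> {linear V -> R}),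
  (forall i, continuous (p i)) /\ forall v, v = \sum_i p i v *: e i.

Definition C1_at f x := forall v,
  (\forall y \near x, derivable f y v) /\ {for x, continuous (fun y => 'D_v f y)}.

(** The mean value theorem on the segment starting at [y] turns the increment into a derivative at a
    point near [x]; continuity of that derivative bounds the error for all [y] near [x] at once. *)
Lemma C1_at_line f x v (eps : R) : C1_at f x -> 0 < eps ->
  exists2 d : R, 0 < d & forall (y : V) (t : R), `|y - x| < d -> `|t| < d ->
    `|f (y + t *: v) - f y - 'D_v f x * t| <= eps * `|t|.
Proof.
move=> /(_ v)[dfv cfv] e0.
have : \forall y \near x, derivable f y v /\ `|'D_v f x - 'D_v f y| <= eps.
  by apply: filterI => //; move/cvgrPdist_le : cfv; exact.
move=> /nbhs_ballP[r /= r0 br].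
(* Half of [r] is kept for [y - x], half for the displacement along [v]; the [1 +] covers
   [v = 0]. *)
have d0 : 0 < r / (2 * (1 + `|v|)).
  by rewrite divr_gt0// mulr_gt0// ltr_pwDl.
exists (Num.min (r / 2) (r / (2 * (1 + `|v|)))).
  by rewrite lt_min d0 divr_gt0.
move=> y t; rewrite lt_min => /andP[yx _]; rewrite lt_min => /andP[_ td].
have near_x (s : R) : `|s| <= `|t| -> ball x r (y + s *: v).
  move=> st; rewrite -ball_normE /= distrC addrAC.
  rewrite (le_lt_trans (ler_normD _ _))// [ltRHS]splitr ltr_leD// normrZ.
  have : `|s| <= r / (2 * (1 + `|v|)) by rewrite (le_trans st)// ltW.
  rewrite ler_pdivlMr ?mulr_gt0 ?ltr_pwDl// => H.
  rewrite ler_pdivlMr// (le_trans _ H)//.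
  by rewrite -mulrA ler_wpM2l// mulrC ler_wpM2l// lerDr.
have [s st ->] := MVT_line (fun s st => (br _ (near_x s st)).1).
rewrite -mulrBl normrM ler_wpM2r// distrC.
exact: (br _ (near_x s st)).2.
Qed.

(** The increment [h] is spent one coordinate at a time. Each intermediate point is a new base
    point, which is why [C1_at_line] is uniform in it. *)
Lemma C1_at_strict f x : fin_dim -> C1_at f x ->
  exists2 L : {linear V -> R}, continuous L & forall eps : R, 0 < eps ->
  exists2 d : R, 0 < d & forall y h : V, `|y - x| < d -> `|h| < d ->
    `|f (y + h) - f y - L h| <= eps * `|h|.
Proof.
move=> [I [e [p [cp pe]]]] c1.
pose l h : R := \sum_i p i h * 'D_(e i) f x.
have llin : linear l.
  move=> a u v; rewrite /l scaler_sumr -big_split /=; apply: eq_bigr => i _.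
  by rewrite linearP mulrDl -mulrA.
pose lM := GRing.isLinear.Build _ _ _ _ _ llin.
pose L : {linear V -> R} := HB.pack l lM.
exists L.
  apply: (@continuous_big _ _ _ _ (fun=> true) add_continuous _ _
            (fun i h => p i h * 'D_(e i) f x)) => i _ z.
  by apply: cvgMr_tmp; apply: cp.
suff key (s : seq I) (eps : R) : 0 < eps ->
    exists2 d : R, 0 < d & forall y h : V, `|y - x| < d -> `|h| < d ->
    `|f (y + \sum_(i <- s) p i h *: e i) - f y - \sum_(i <- s) p i h * 'D_(e i) f x|
       <= eps * `|h|.
  move=> eps /(key (index_enum I))[d d0 H]; exists d => // y h yx hd.
  by have := H _ _ yx hd; rewrite -pe.
elim: s eps => [|i s IH] eps e0.
  by exists 1 => // y h _ _; rewrite !big_nil addr0 !subrr normr0 mulr_ge0// ltW.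
have [d1 d10 H1] := IH (eps / 2) (divr_gt0 e0 (ltr0Sn R 1)).
have [k k0 pk] : exists2 k, k > 0 & forall h, `|p i h| <= k * `|h|.
  by have [k [k0 H]] := linear_lipschitz (cp i); exists k.
have [d2 d20 H2] := C1_at_line (e i) c1 (divr_gt0 e0 (mulr_gt0 (ltr0Sn R 1) k0)).
pose b := `|p i 0| + k * (1 + `|e i|) + 1.
have b0 : 0 < k * (1 + `|e i|) by rewrite mulr_gt0// ltr_pwDl.
(* [d1 / 2] and [d2] confine [y]; [d2 / k] makes the coordinate [p i h] smaller than [d2]; the last
   bound keeps [y] shifted along [e i] within [d1] of [x]. *)
pose d := Num.min (Num.min (d1/2) (d2)) (Num.min (d2 / k) (d1 / 2 / (k * (1 + `|e i|)))).
exists d; first by rewrite !lt_min !divr_gt0// d20.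
move=> y h; rewrite !lt_min => /andP[/andP[y1 y2] _].
move=> /andP[/andP[h1 _] /andP[h3 h4]].
rewrite !big_cons /=.
set S := \sum_(_ <- s) _; set S' := \sum_(_ <- s) _.
have ph : `|p i h| < d2.
  by rewrite (le_lt_trans (pk h))// mulrC -ltr_pdivlMr.
have yh : `|y + p i h *: e i - x| < d1.
  rewrite addrAC (le_lt_trans (ler_normD _ _))// [ltRHS]splitr ltr_leD// normrZ.
  move: h4; rewrite ltr_pdivlMr// => /ltW h4; apply: le_trans h4.
  rewrite mulrCA mulrA ler_pM// lerDr//.
have E : f (y + (p i h *: e i + S)) - f y - (p i h * 'D_(e i) f x + S') =
  (f (y + p i h *: e i + S) - f (y + p i h *: e i) - S') +
  (f (y + p i h *: e i) - f y - 'D_(e i) f x * p i h).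
  by rewrite addrA; ring.
rewrite E (le_trans (ler_normD _ _))// [eps in leRHS]splitr mulrDl lerD//.
  apply: H1 => //; apply: (lt_trans h1); rewrite ltr_pdivrMr// mulr_natr mulr2n.
  by rewrite ltrDl.
apply: le_trans (H2 _ _ y2 ph) _.
rewrite (le_trans (ler_wpM2l _ (pk h)))//; first by rewrite ltW// divr_gt0// mulr_gt0.
by rewrite invfM mulrA mulrA divfK// gt_eqF.
Qed.

Lemma C1_at_strictly_differentiable f x : fin_dim -> C1_at f x ->
  differentiable f x /\ forall eps : R, 0 < eps ->
  exists2 d : R, 0 < d & forall y h : V, `|y - x| < d -> `|h| < d ->
    `|f (y + h) - f y - 'D_h f x| <= eps * `|h|.
Proof.
move=> fd /(C1_at_strict fd)[L cL H].
have E : f \o shift x = cst (f x) + L +o_ 0 id.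
  apply/eqaddoP => _/posnumP[eps]; have [d d0 Hd] := H eps%:num [gt0 of eps%:num].
  apply/nbhs_ballP; exists d => //= h; rewrite -ball_normE /= sub0r normrN => hd.
  have := Hd x h; rewrite subrr normr0 => /(_ d0 hd).
  by rewrite !fctE /= [h + x]addrC opprD addrA.
have DL := diff_unique cL E.
have df : differentiable f x by apply/diff_locallyP; rewrite DL.
split => // eps /H[d d0 Hd]; exists d => // y h yx hd.
by rewrite deriveE// DL; exact: Hd.
Qed.

Lemma C1_at_differentiable f x : fin_dim -> C1_at f x -> differentiable f x.
Proof. by move=> fd /(C1_at_strictly_differentiable fd)[]. Qed.

End Differentiability.

(** * Functions of class C^k in coordinates *)

Section FinDim.
Variable R : realType.

Definition coord_linear n (i : 'I_n) : {linear 'rV[R]_n -> R} :=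
  HB.pack (fun v : 'rV[R]_n => v 0 i)
    (GRing.isLinear.Build R 'rV[R]_n R _ (fun v : 'rV[R]_n => v 0 i)
      (fun a u v => etrans (mxE _ _ _ _) (congr1 (+%R^~ (v 0 i)) (mxE _ _ _ _)))).

Lemma fin_dim_rV n : fin_dim 'rV[R]_n.
Proof.
exists 'I_n, (fun i => delta_mx 0 i), (@coord_linear n); split.
  by move=> i; apply: coord_continuous.
by move=> v; apply: row_sum_delta.
Qed.

Lemma fin_dim_prod (V W : normedModType R) :
  fin_dim V -> fin_dim W -> fin_dim (V * W)%type.
Proof.
move=> [I [e [p [cp pe]]]] [J [e' [p' [cp' pe']]]].
have lfst : linear (fst : (V * W)%type -> V) by [].
have lsnd : linear (snd : (V * W)%type -> W) by [].
pose fstL : {linear (V * W)%type -> V} :=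
  HB.pack (fst : (V * W)%type -> V) (GRing.isLinear.Build _ _ _ _ _ lfst).
pose sndL : {linear (V * W)%type -> W} :=
  HB.pack (snd : (V * W)%type -> W) (GRing.isLinear.Build _ _ _ _ _ lsnd).
exists (I + J)%type, (fun k => match k with inl i => (e i, 0) | inr j => (0, e' j) end).
exists (fun k => match k with
  | inl i => (p i \o fstL : {linear (V * W)%type -> R})
  | inr j => (p' j \o sndL : {linear (V * W)%type -> R}) end).
split.
  by case=> [i|j] z; apply: continuous_comp; [exact: cvg_fst|exact: cp|exact: cvg_snd|exact: cp'].
move=> [v w]; rewrite big_sumType /=.
have E1 : \sum_i p i v *: ((e i, 0) : (V * W)%type) = (v, 0).
  rewrite [in RHS](pe v); elim/big_ind2 : _ => //= [a b c d -> ->|i _].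
    by rewrite -[LHS]/(_ + _, _ + _) addr0.
  by rewrite -[LHS]/(_ *: _, _ *: _) scaler0.
have E2 : \sum_i p' i w *: ((0, e' i) : (V * W)%type) = (0, w).
  rewrite [in RHS](pe' w); elim/big_ind2 : _ => //= [a b c d -> ->|i _].
    by rewrite -[LHS]/(_ + _, _ + _) addr0.
  by rewrite -[LHS]/(_ *: _, _ *: _) scaler0.
by rewrite E1 E2 -[RHS]/(_ + _, _ + _) addr0 add0r.
Qed.

End FinDim.

Section Rows.
Variables (R : realType) (V : normedModType R) (n : nat).
Implicit Types f : V -> 'rV[R]_n.

Lemma row_fun_sum f : f = \sum_i (fun x => f x 0 i *: delta_mx 0 i).
Proof.
by apply/funext => x; rewrite fct_sumE; apply: row_sum_delta.
Qed.

Lemma continuous_row (T : topologicalType) (f : T -> 'rV[R]_n) x :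
  {for x, continuous f} <-> forall i, {for x, continuous (fun y => f y 0 i)}.
Proof.
split=> [cf i|cf].
  by apply: (@continuous_comp _ _ _ f (fun M : 'rV[R]_n => M 0 i)) => //; exact: coord_continuous.
have -> : f = (fun x => \sum_i f x 0 i *: delta_mx 0 i).
  by apply/funext => y; apply: row_sum_delta.
rewrite /prop_for /continuous_at.
apply: (@cvg_big _ _ _ _ (fun=> true) add_continuous _ _ _
          (fun i h => f h 0 i *: delta_mx 0 i)) => i _.
by apply: cvgZr_tmp; apply: cf.
Qed.

Lemma differentiable_row f x :
  (forall i, differentiable (fun y => f y 0 i) x) -> differentiable f x.
Proof.
move=> df; rewrite [f]row_fun_sum; apply: differentiable_sum => i.
exact: differentiableZl.
Qed.

Lemma derivable_row f x v :
  derivable f x v <-> forall i, derivable (fun y => f y 0 i) x v.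
Proof.
split=> [/derivable_mxP H i|H]; first exact: H.
by apply/derivable_mxP => i j; rewrite ord1.
Qed.

Lemma derive_row f x v i :
  derivable f x v -> 'D_v f x 0 i = 'D_v (fun y => f y 0 i) x.
Proof. by move=> /derive_mx ->; rewrite mxE. Qed.

Lemma is_derive_row f x v df i :
  is_derive x v f df -> is_derive x v (fun y => f y 0 i) (df 0 i).
Proof.
by move=> [d <-]; split; [exact: (derivable_row f x v).1|rewrite derive_row].
Qed.

End Rows.

Section Ck.
Variables (R : realType) (V W : normedModType R).
Implicit Types (f g : V -> W) (U : set V).

Lemma Ck_on_continuous k U f x : Ck_on k U f -> U x -> {for x, continuous f}.
Proof. by case: k => [|k] [H _] Ux; apply: H. Qed.

Lemma Ck_on_derivable k U f x v : Ck_on k.+1 U f -> U x -> derivable f x v.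
Proof. by move=> [_ /(_ v)[H _]]; apply: H. Qed.

Lemma Ck_on_derive k U f v : Ck_on k.+1 U f -> Ck_on k U ('D_v f).
Proof. by move=> [_ /(_ v)[_ H]]. Qed.

Lemma Ck_on_pred k U f : Ck_on k.+1 U f -> Ck_on k U f.
Proof.
elim: k f => [|k IH] f [cf df]; first by split.
by split => // v; split; [exact: (df v).1|apply: IH; exact: (df v).2].
Qed.

Lemma Ck_on_sub k U U' f : U' `<=` U -> Ck_on k U f -> Ck_on k U' f.
Proof.
move=> UU; elim: k f => [|k IH] f [cf df]; split => //.
- by move=> x /UU; apply: cf.
- by move=> x /UU; apply: cf.
- by move=> v; split; [move=> x /UU; exact: (df v).1|apply: IH; exact: (df v).2].
Qed.

Lemma Ck_on_ext k U f g : open U -> (forall x, U x -> f x = g x) ->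
  Ck_on k U f -> Ck_on k U g.
Proof.
move=> oU; elim: k f g => [|k IH] f g fg.
all: have nfg x : U x -> {near x, f =1 g}
  by move=> Ux; have := open_nbhs_nbhs (conj oU Ux); apply: filterS.
all: move=> [cf df]; split => //.
1,2: move=> x Ux; rewrite /prop_for /continuous_at -(fg _ Ux);
     by apply: cvg_trans (cf _ Ux); apply: near_eq_cvg; exact: nfg.
move=> v; split.
  by move=> x Ux; apply: near_eq_derivable (nfg _ Ux) _; exact: (df v).1.
apply: IH (df v).2 => x Ux; apply: near_eq_derive; exact: nfg.
Unshelve. all: by end_near. Qed.

Lemma Ck_on_cst k U c : Ck_on k U (cst c : V -> W).
Proof.
elim: k c => [|k IH] c; split => //; try by move=> x _; exact: cst_continuous.
move=> v; split; first by move=> x _; exact: derivable_cst.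
have -> : 'D_v (cst c : V -> W) = cst 0 by apply/funext => x; rewrite derive_cst.
exact: IH.
Qed.

Lemma Ck_onD k U f g : open U ->
  Ck_on k U f -> Ck_on k U g -> Ck_on k U (fun x => f x + g x).
Proof.
move=> oU; elim: k f g => [|k IH] f g [cf df] [cg dg].
all: split => //.
1,2: by move=> x Ux; apply: continuousD; [exact: cf|exact: cg].
move=> v; split.
  by move=> x Ux; apply: derivableD; [exact: (df v).1|exact: (dg v).1].
apply: Ck_on_ext oU _ (IH _ _ (df v).2 (dg v).2) => x Ux.
by rewrite deriveD//; [exact: (df v).1|exact: (dg v).1].
Qed.

Lemma smooth_on_continuous U f x : smooth_on U f -> U x -> {for x, continuous f}.
Proof. by move=> /(_ 0) sf; exact: Ck_on_continuous sf. Qed.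

Lemma smooth_on_derivable U f x v : smooth_on U f -> U x -> derivable f x v.
Proof. by move=> /(_ 1) sf; exact: Ck_on_derivable sf. Qed.

Lemma smooth_on_derive U f v : smooth_on U f -> smooth_on U ('D_v f).
Proof. by move=> sf k; apply: Ck_on_derive (sf k.+1). Qed.

End Ck.

Section CkReal.
Variables (R : realType) (V : normedModType R).
Implicit Types (f g : V -> R) (U : set V).

Lemma Ck_onM k U f g : open U ->
  Ck_on k U f -> Ck_on k U g -> Ck_on k U (fun x => f x * g x).
Proof.
move=> oU; elim: k f g => [|k IH] f g.
all: move=> Cf Cg; have [cf df] := Cf; have [cg dg] := Cg; split => //.
1,2: by move=> x Ux; apply: continuousM; [exact: cf|exact: cg].
move=> v; split.
  by move=> x Ux; apply: derivableM; [exact: (df v).1|exact: (dg v).1].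
have Ck' := Ck_onD oU (IH _ _ (Ck_on_pred Cf) (dg v).2) (IH _ _ (Ck_on_pred Cg) (df v).2).
apply: Ck_on_ext oU _ Ck' => x Ux.
by rewrite deriveM//; [exact: (df v).1|exact: (dg v).1].
Qed.

Lemma Ck_on_sum k U (I : Type) (r : seq I) (f : I -> V -> R) : open U ->
  (forall i, Ck_on k U (f i)) -> Ck_on k U (fun x => \sum_(i <- r) f i x).
Proof.
move=> oU Cf; elim: r => [|i r IH].
  by under eq_fun do rewrite big_nil; exact: Ck_on_cst.
by under eq_fun do rewrite big_cons; exact: Ck_onD.
Qed.

Lemma smooth_on_C1_at U f x : open U -> smooth_on U f -> U x -> C1_at f x.
Proof.
move=> oU sf Ux v; split.
  by have := open_nbhs_nbhs (conj oU Ux); apply: filterS => y; exact: smooth_on_derivable.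
exact: smooth_on_continuous (smooth_on_derive _ sf) Ux.
Qed.

Lemma smooth_on_differentiable U f x : fin_dim V -> open U -> smooth_on U f ->
  U x -> differentiable f x.
Proof.
by move=> fd oU sf Ux; apply: C1_at_differentiable => //; exact: smooth_on_C1_at Ux.
Qed.

End CkReal.

Section CkRow.
Variables (R : realType) (V : normedModType R) (n : nat).
Implicit Types (f : V -> 'rV[R]_n) (U : set V).

Lemma Ck_on_row k U f : open U ->
  Ck_on k U f <-> forall i, Ck_on k U (fun x => f x 0 i).
Proof.
move=> oU; elim: k f => [|k IH] f.
  split=> [[cf _] i|H]; split => // x Ux; first exact: (continuous_row f x).1 (cf x Ux) i.
  by apply/continuous_row => i; have [cfi _] := H i; exact: cfi.
split=> [[cf df] i|H].
  split; first by move=> x Ux; have /continuous_row := cf x Ux; exact.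
  move=> v; split.
    by move=> x Ux; exact: (derivable_row f x v).1 ((df v).1 x Ux) i.
  apply: Ck_on_ext oU _ ((IH _).1 (df v).2 i) => x Ux.
  by apply: derive_row; exact: (df v).1.
have dv x v : U x -> derivable f x v.
  by move=> Ux; apply/derivable_row => i; exact: Ck_on_derivable (H i) Ux.
split; first by move=> x Ux; apply/continuous_row => i; have [cfi _] := H i; exact: cfi.
move=> v; split; first by move=> x Ux; exact: dv.
apply/IH => i; apply: Ck_on_ext oU _ (Ck_on_derive v (H i)) => x Ux.
by apply/esym/derive_row/dv.
Qed.

Lemma smooth_on_coord U f i : open U -> smooth_on U f -> smooth_on U (fun x => f x 0 i).
Proof. by move=> oU sf k; apply: (Ck_on_row k _ oU).1. Qed.

Lemma smooth_on_row_differentiable U f x : fin_dim V -> open U -> smooth_on U f ->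
  U x -> differentiable f x.
Proof.
move=> fd oU sf Ux; apply: differentiable_row => i.
exact: smooth_on_differentiable (smooth_on_coord _ oU sf) Ux.
Qed.

End CkRow.

(** * Chain rule and symmetry of second derivatives *)

Section ChainRule.
Variables (R : realType) (U V W : normedModType R).

(** Only the derivative of [x] along [v] at [t] is available, so [x] is restricted to the line
    through [t], where derivable and differentiable coincide. *)
Lemma is_derive_comp (x : U -> V) (f : V -> W) t v dx :
  is_derive t v x dx -> differentiable f (x t) ->
  is_derive t v (f \o x) ('D_dx f (x t)).
Proof.
move=> [dxt <-] df.
pose g (h : R) := x (h *: v + t).
have g0 : g 0 = x t by rewrite /g scale0r add0r.
have dg : differentiable g 0 by apply/derivable1_diffP; exact: (derivable1P x t v).1.
have line (X : normedModType R) (k : U -> X) : 'D_v k t = 'D_1 (fun h : R => k (h *: v + t)) 0.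
  by apply: derive_same_line => h; rewrite [h *: 1]mulr1 addr0.
have dfg : differentiable (f \o g) 0 by apply: differentiable_comp; rewrite ?g0.
split.
  have [_ H] := derivable1P (f \o x) t v; apply: H.
  by have [_ H] := derivable1_diffP (f \o g) 0; apply: H.
rewrite line -[LHS]/('D_1 (f \o g) 0) deriveE//. rewrite diff_comp ?g0//=.
by rewrite line [in RHS]deriveE// [in RHS]deriveE.
Qed.

End ChainRule.

Lemma is_derive_pair (R : realType) (V W : normedModType R) (f : R -> V) (g : R -> W)
    (t : R) df dg :
  is_derive t 1 f df -> is_derive t 1 g dg ->
  is_derive t 1 (fun r => (f r, g r)) (df, dg).
Proof.
move=> [/derivable1_diffP d1 <-] [/derivable1_diffP d2 <-].
have dfg := differentiable_pair d1 d2.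
by split; [exact: diff_derivable|rewrite deriveE// diff_pair// -!deriveE].
Qed.

Lemma is_derive_graph (R : realType) (V W : normedModType R) (f : V -> W) x v :
  differentiable f x -> is_derive x v (fun y => (y, f y)) (v, 'D_v f x).
Proof.
move=> df; have di : differentiable (@idfun V) x by [].
have dif := differentiable_pair di df.
split; first exact: diff_derivable.
by rewrite deriveE// diff_pair// -!deriveE// derive_id.
Qed.

Lemma is_derive_scale_direction (R : realType) (W : normedModType R) (f : R -> W)
    (t v : R) df : is_derive t 1 f df -> is_derive t v f (v *: df).
Proof.
move=> [/derivable1_diffP d <-]; split; first exact: diff_derivable.
by rewrite !deriveE// -linearZ /= [v *: 1]mulr1.
Qed.

Lemma derive_coord_sum (R : realType) (W : normedModType R) n
    (f : 'rV[R]_n -> W) x v : differentiable f x ->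
  'D_v f x = \sum_i v 0 i *: 'D_(delta_mx 0 i) f x.
Proof.
move=> df; rewrite deriveE// {1}(row_sum_delta v) linear_sum; apply: eq_bigr => i _.
by rewrite linearZ /= deriveE.
Qed.

Section Schwarz.
Variables (R : realType) (V : normedModType R).
Implicit Types (f : V -> R) (U : set V).

(** The mean value theorem twice: along [u] for the increment of [f] in direction [v], then along
    [v] for the derivative of [f] in direction [u]. *)
Lemma second_MVT U f x u v (t : R) : smooth_on U f ->
  (forall s r : R, `|s| <= `|t| -> `|r| <= `|t| -> U (x + s *: u + r *: v)) ->
  exists s r : R, [/\ `|s| <= `|t|, `|r| <= `|t| &
    f (x + t *: u + t *: v) - f (x + t *: u) - (f (x + t *: v) - f x) =
    'D_v ('D_u f) (x + s *: u + r *: v) * t * t].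
Proof.
move=> sf Ut; pose g y := f (y + t *: v) - f y.
have dg (s : R) : `|s| <= `|t| -> is_derive (x + s *: u) u g
    ('D_u f (x + s *: u + t *: v) - 'D_u f (x + s *: u)).
  move=> st; apply: is_deriveB.
    apply/is_derive_translate/derivableP; apply: smooth_on_derivable sf _.
    exact: Ut.
  apply/derivableP; apply: smooth_on_derivable sf _.
  by have := Ut s 0 st; rewrite normr0 scale0r addr0; apply.
have [s st] := @MVT_line _ _ g x u t (fun s st => @ex_derive _ _ _ _ _ _ _ (dg s st)).
rewrite (@derive_val _ _ _ _ _ _ _ (dg s st)) => E.
have [|r rt E'] := @MVT_line _ _ ('D_u f) (x + s *: u) v t.
  move=> r rt; exact: smooth_on_derivable (smooth_on_derive _ sf) (Ut _ _ st rt).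
exists s, r; split => //.
by rewrite -E' -E /g [x + t *: u + t *: v]addrAC addrAC.
Qed.

(** The second difference over a small parallelogram is symmetric in [u] and [v], so the two mixed
    derivatives take a common value at two points close to [x]; continuity does the rest. *)
Lemma derive_comm U f x u v : open U -> smooth_on U f -> U x ->
  'D_v ('D_u f) x = 'D_u ('D_v f) x.
Proof.
move=> oU sf Ux; apply/eqP; rewrite -subr_eq0 -normr_le0.
apply/ler_addgt0Pr => eps e0; rewrite add0r.
have close a b : \forall y \near x, `|'D_a ('D_b f) x - 'D_a ('D_b f) y| <= eps / 2.
  have /cvgrPdist_le := smooth_on_continuous (smooth_on_derive a (smooth_on_derive b sf)) Ux.
  by apply; rewrite divr_gt0.
have : \forall y \near x, [/\ U y, `|'D_v ('D_u f) x - 'D_v ('D_u f) y| <= eps / 2 &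
   `|'D_u ('D_v f) x - 'D_u ('D_v f) y| <= eps / 2].
  have n1 := open_nbhs_nbhs (conj oU Ux).
  by apply: filterS3 n1 (close v u) (close u v) => y; split.
move=> /nbhs_ballP[r /= r0 br].
pose t := r / (2 * (1 + `|u| + `|v|)).
have k0 : 0 < 1 + `|u| + `|v| by rewrite -addrA ltr_pwDl// addr_ge0.
have t0 : 0 < t by rewrite divr_gt0// mulr_gt0.
have near_x a b (s q : R) : `|a| + `|b| <= `|u| + `|v| ->
    `|s| <= `|t| -> `|q| <= `|t| -> ball x r (x + s *: a + q *: b).
  move=> ab st qt; rewrite -ball_normE /= -addrA opprD addrA subrr sub0r normrN.
  rewrite (le_lt_trans (ler_normD _ _))// !normrZ.
  have : t * (1 + `|u| + `|v|) < r.
    by rewrite /t invfM mulrA divfK ?gt_eqF// ltr_pdivrMr// mulr_natr mulr2n ltrDl.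
  apply: le_lt_trans; rewrite (gtr0_norm t0) in st qt.
  rewrite -addrA mulrDr mulr1 (le_trans (lerD (ler_wpM2r _ st) (ler_wpM2r _ qt)))//.
  rewrite -mulrDr -[leLHS]add0r lerD// ?(ltW t0)//.
  by rewrite ler_wpM2l// ltW.
have [s [q [st qt E1]]] := second_MVT sf
  (fun s q st qt => let: And3 h _ _ := br _ (near_x u v s q (lexx _) st qt) in h).
have vu : `|v| + `|u| <= `|u| + `|v| by rewrite addrC.
have [s' [q' [st' qt' E2]]] := second_MVT sf
  (fun s q st qt => let: And3 h _ _ := br _ (near_x v u s q vu st qt) in h).
have E : 'D_v ('D_u f) (x + s *: u + q *: v) = 'D_u ('D_v f) (x + s' *: v + q' *: u).
  have tt : t * t != 0 by rewrite mulf_neq0// gt_eqF.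
  have swap (a b c d : R) : a - b - (c - d) = a - c - (b - d) by ring.
  by apply: (mulIf tt); rewrite [LHS]mulrA [RHS]mulrA -E1 -E2 [x + t *: v + t *: u]addrAC swap.
have [_ H1 _] := br _ (near_x _ _ _ _ (lexx _) st qt).
have [_ _ H2] := br _ (near_x _ _ _ _ vu st' qt').
rewrite -(subrKA ('D_v ('D_u f) (x + s *: u + q *: v))) [leRHS]splitr.
apply: le_trans (ler_normD _ _) _; apply: lerD; first exact: H1.
by rewrite E distrC; exact: H2.
Qed.

End Schwarz.

Lemma derive_row_comm (R : realType) (V : normedModType R) n (U : set V)
    (f : V -> 'rV[R]_n) x u v : open U -> smooth_on U f -> U x ->
  'D_v ('D_u f) x = 'D_u ('D_v f) x.
Proof.
move=> oU sf Ux; apply/rowP => i.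
have D a b : 'D_a ('D_b f) x 0 i = 'D_a ('D_b (fun y => f y 0 i)) x.
  rewrite derive_row; last exact: smooth_on_derivable (smooth_on_derive _ sf) Ux.
  apply: near_eq_derive; have := open_nbhs_nbhs (conj oU Ux); apply: filterS => y Uy.
  by apply: derive_row; exact: smooth_on_derivable sf Uy.
apply: etrans (D v u) _; apply: etrans _ (esym (D u v)).
exact: derive_comm oU (smooth_on_coord i oU sf) Ux.
Qed.

Section Composition.
Variables (R : realType) (n : nat).

(** In coordinates the derivative of the composite is a sum of products in which partial derivatives
    of [f] replace [f]; the induction therefore runs over all [f]. *)
Lemma Ck_on_comp_curve k (U : set R) (O : set 'rV[R]_n) (f : 'rV[R]_n -> R) (x : R -> 'rV[R]_n) :
  open U -> open O -> smooth_on O f -> Ck_on k U x -> (forall t, U t -> O (x t)) ->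
  Ck_on k U (f \o x).
Proof.
move=> oU oO; elim: k f => [|k IH] f sf Cx UO.
  split => // t Ut; apply: continuous_comp; first exact: Ck_on_continuous Cx Ut.
  exact: smooth_on_continuous sf (UO _ Ut).
split.
  move=> t Ut; apply: continuous_comp; first exact: Ck_on_continuous Cx Ut.
  exact: smooth_on_continuous sf (UO _ Ut).
have df t : U t -> differentiable f (x t).
  by move=> Ut; exact: smooth_on_differentiable (fin_dim_rV _ _) oO sf (UO _ Ut).
have D v t : U t -> is_derive t v (f \o x) ('D_('D_v x t) f (x t)).
  by move=> Ut; apply: is_derive_comp (df _ Ut); apply/derivableP; exact: Ck_on_derivable Cx Ut.
move=> v; split; first by move=> t Ut; have [] := D v t Ut.
have C : Ck_on k U (fun t => \sum_i 'D_v x t 0 i * ('D_(delta_mx 0 i) f \o x) t).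
  apply: (Ck_on_sum _ oU) => i; apply: (Ck_onM oU).
    exact: (Ck_on_row k _ oU).1 (Ck_on_derive v Cx) i.
  exact: IH (smooth_on_derive _ sf) (Ck_on_pred Cx) UO.
apply: (Ck_on_ext oU _ C) => t Ut.
by rewrite (@derive_val _ _ _ _ _ _ _ (D v t Ut)) derive_coord_sum//; exact: df.
Qed.

End Composition.

Lemma continuous_pair (X Y Z : topologicalType) (f : X -> Y) (g : X -> Z) (x : X) :
  {for x, continuous f} -> {for x, continuous g} ->
  {for x, continuous (fun y => (f y, g y))}.
Proof. by move=> cf cg; apply: cvg_pair. Qed.

(** * Freezing one variable of a map on a product *)

Section Slices.
Variables (R : realType) (V V' W : normedModType R).

Lemma derive_slice (f : V * V' -> W) (w : V) (x v : V') :
  'D_v (fun y => f (w, y)) x = 'D_(0, v) f (w, x).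
Proof.
apply: derive_same_line => h.
by rewrite -[X in _ = f X]/(_, _) /= scaler0 add0r.
Qed.

Lemma derivable_slice (f : V * V' -> W) (w : V) (x v : V') :
  derivable f (w, x) (0, v) <-> derivable (fun y => f (w, y)) x v.
Proof.
have H : forall h : R, f (h *: (0, v) + (w, x)) = f (w, h *: v + x).
  by move=> h; rewrite -[X in f X]/(_, _) /= scaler0 add0r.
have S df := @is_derive_same_line _ _ _ _ f (fun y => f (w, y)) _ _ _ _ df H.
by split=> /derivableP /S[].
Qed.

Lemma continuous_slice (X Y Z : topologicalType) (f : X * Y -> Z) (w : X) (x : Y) :
  {for (w, x), continuous f} -> {for x, continuous (fun y => f (w, y))}.
Proof.
move=> cf; apply: (@continuous_comp _ _ _ (fun y : Y => (w, y)) f) => //.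
by apply: cvg_pair; [exact: cvg_cst|exact: cvg_id].
Qed.

Lemma smooth_on_slice (O : set (V * V')) (f : (V * V')%type -> W) (w : V) :
  smooth_on O f -> smooth_on [set x | O (w, x)] (fun x => f (w, x)).
Proof.
move=> sf k; elim: k f sf => [|k IH] f sf; (split; first by
  move=> x Ox; apply: continuous_slice; exact: smooth_on_continuous sf Ox) => //.
move=> v; split.
  by move=> x Ox; apply/derivable_slice; exact: smooth_on_derivable sf Ox.
have -> : 'D_v (fun x => f (w, x)) = fun x => 'D_(0, v) f (w, x).
  by apply/funext => x; exact: derive_slice.
exact: IH (smooth_on_derive _ sf).
Qed.

End Slices.

(** * The geodesic equation in Euler-Lagrange form *)

(* Unification otherwise unfolds directional derivatives down to limits. *)
Local Opaque derive.

Lemma sum_contract3 (R : realType) n (y : 'rV[R]_n) (a b c : 'I_n -> 'I_n -> R) :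
  \sum_j \sum_k (a j k - b j k + c j k) * y 0 j * y 0 k =
  \sum_j \sum_k a j k * y 0 j * y 0 k - \sum_j \sum_k b j k * y 0 j * y 0 k
  + \sum_j \sum_k c j k * y 0 j * y 0 k.
Proof.
rewrite -sumrB -big_split /=; apply: eq_bigr => j _.
rewrite -sumrB -big_split /=; apply: eq_bigr => k _.
by rewrite !mulrDl !mulNr.
Qed.

Lemma half_sum (R : realType) (p q : R) : 2^-1 * p - q + 2^-1 * p = p - q.
Proof. lra. Qed.

Lemma mul_half_double (R : realType) (a b : R) : a * b = 2 * (2^-1 * b * a).
Proof. by field. Qed.

Section EulerLagrange.
Variables (R : realType) (n : nat) (L : 'rV[R]_n -> 'rV[R]_n -> R) (O : set 'rV[R]_n).
Local Notation V := 'rV[R]_n.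
Hypothesis oO : open O.
Let Dom : set (V * V) := [set z | O z.1 /\ z.2 != 0].
Hypothesis sL : @smooth_on R (V * V)%type R Dom (fun z => L z.1 z.2).
Hypothesis homL : forall (x y : V) (t : R), O x -> 0 <= t -> L x (t *: y) = t * L x y.
Hypothesis posL : forall x y u : V, O x -> y != 0 -> u != 0 ->
  0 < fundamental_form (L x) y u u.

Definition energy (z : (V * V)%type) : R := L z.1 z.2 ^+ 2.
Local Notation Q := energy.
Local Notation "'e_ i" := (delta_mx 0 i : V) (at level 8, i at level 2).
Local Notation eX i := (('e_i, 0) : (V * V)%type).
Local Notation eY i := ((0, 'e_i) : (V * V)%type).

Let fdVV : fin_dim (V * V)%type := fin_dim_prod (fin_dim_rV R n) (fin_dim_rV R n).

Lemma slit_open : open Dom.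
Proof.
have -> : Dom = (fst @^-1` O) `&` (snd @^-1` [set y : V | y != 0]) by [].
apply: openI; apply: open_comp => //.
- by move=> z _; exact: cvg_fst.
- by move=> z _; exact: cvg_snd.
- have -> : [set y : V | y != 0] = ~` [set 0].
    by apply/seteqP; split=> y /= /eqP.
  apply: closed_openC; apply: accessible_closed_set1.
  by apply: hausdorff_accessible; apply: norm_hausdorff.
Qed.

Let oD := slit_open.

Lemma smooth_energy : smooth_on Dom Q.
Proof.
move=> k; have -> : Q = (fun z => L z.1 z.2 * L z.1 z.2).
  by apply/funext => z; rewrite /energy expr2.
by apply: Ck_onM.
Qed.

Let sQ := smooth_energy.

Lemma derive_lin (h : (V * V)%type -> R) z a b : smooth_on Dom h -> Dom z ->
  'D_(a, b) h z = \sum_i a 0 i * 'D_(eX i) h z + \sum_i b 0 i * 'D_(eY i) h z.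
Proof.
move=> sh Dz; have dh := smooth_on_differentiable fdVV oD sh Dz.
have E : ((a, b) : (V * V)%type) = \sum_i (a 0 i *: eX i) + \sum_i (b 0 i *: eY i).
  have E1 : (a, 0) = \sum_i (a 0 i *: eX i).
    rewrite [in LHS](row_sum_delta a); elim/big_ind2 : _ => //= [c d e f <- <-|i _].
      by rewrite -[RHS]/(_ + _, _ + _) addr0.
    by rewrite -[RHS]/(_ *: _, _ *: _) scaler0.
  have E2 : (0, b) = \sum_i (b 0 i *: eY i).
    rewrite [in LHS](row_sum_delta b); elim/big_ind2 : _ => //= [c d e f <- <-|i _].
      by rewrite -[RHS]/(_ + _, _ + _) addr0.
    by rewrite -[RHS]/(_ *: _, _ *: _) scaler0.
  by rewrite -E1 -E2 -[RHS]/(_ + _, _ + _) addr0 add0r.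
rewrite deriveE// E linearD !linear_sum; congr (_ + _); apply: eq_bigr => i _;
  by rewrite linearZ /= deriveE.
Qed.

Lemma fundamental_formE (x y u v : V) :
  fundamental_form (L x) y u v = 2^-1 * 'D_(0, u) ('D_(0, v) Q) (x, y).
Proof.
rewrite /fundamental_form derive1E.
apply: (congr1 ( *%R 2^-1)).
apply: derive_same_line => h.
rewrite derive1E [h *: 1]mulr1 addr0.
apply: derive_same_line => k.
rewrite [k *: 1]mulr1 addr0 /energy.
rewrite -[RHS]/(L (k *: 0 + (h *: 0 + x)) (k *: v + (h *: u + y)) ^+ 2).
rewrite !scaler0 !add0r. congr (L x _ ^+ 2).
by rewrite [RHS]addrC [h *: u + y]addrC.
Qed.

Definition metric_fun i j (z : (V * V)%type) : R := 2^-1 * 'D_(eY i) ('D_(eY j) Q) z.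

Lemma metricE i j (x y : V) : metric L i j x y = metric_fun i j (x, y).
Proof. by rewrite /metric fundamental_formE. Qed.

Lemma dx_metric k i j (x y : V) : dx k (metric L i j) x y = 'D_(eX k) (metric_fun i j) (x, y).
Proof.
apply: derive_same_line => h; rewrite metricE.
by rewrite -[RHS]/(metric_fun i j (h *: 'e_k + x, h *: 0 + y)) scaler0 add0r.
Qed.

Lemma dy_metric k i j (x y : V) : dy k (metric L i j) x y = 'D_(eY k) (metric_fun i j) (x, y).
Proof.
apply: derive_same_line => h; rewrite metricE.
by rewrite -[RHS]/(metric_fun i j (h *: 0 + x, h *: 'e_k + y)) scaler0 add0r.
Qed.

Lemma derive_metric_fun w i j z : Dom z ->
  'D_w (metric_fun i j) z = 2^-1 * 'D_w ('D_(eY i) ('D_(eY j) Q)) z.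
Proof.
move=> Dz; apply: (@deriveMl R (V * V)%type).
exact: smooth_on_derivable (smooth_on_derive _ (smooth_on_derive _ sQ)) Dz.
Qed.

Lemma derive_comm3 u v w z : Dom z ->
  'D_w ('D_u ('D_v Q)) z = 'D_v ('D_w ('D_u Q)) z.
Proof.
move=> Dz; apply: etrans (derive_comm _ _ oD (smooth_on_derive u sQ) Dz).
apply: near_eq_derive; have := open_nbhs_nbhs (conj oD Dz); apply: filterS => z' Dz'.
exact: derive_comm oD sQ Dz'.
Qed.

Lemma metric_fun_sym i j z : Dom z -> metric_fun i j z = metric_fun j i z.
Proof. by move=> Dz; rewrite /metric_fun (derive_comm (eY j) (eY i) oD sQ Dz). Qed.

Definition homogeneous d (h : (V * V)%type -> R) := forall (x y : V) (t : R),
  Dom (x, y) -> 0 < t -> h (x, t *: y) = t ^+ d * h (x, y).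

Lemma Dom_scale (x y : V) (t : R) : Dom (x, y) -> 0 < t -> Dom (x, t *: y).
Proof.
by move=> [/= Ox y0] t0; split => //=; rewrite scaler_eq0 negb_or gt_eqF.
Qed.

Lemma homogeneous_energy : homogeneous 2 Q.
Proof. by move=> x y t [/= Ox _] t0; rewrite /energy /= homL ?ltW// exprMn. Qed.

Lemma Dom_line z v : Dom z -> \forall s \near (0 : R), Dom (s *: v + z).
Proof.
move=> Dz.
have : {for (0 : R), continuous (fun s : R => s *: v + z)}.
  by apply: continuousD; [exact: scalel_continuous|exact: cst_continuous].
move=> /(_ Dom); rewrite scale0r add0r; apply.
exact: open_nbhs_nbhs.
Qed.

Lemma derive_line (h : (V * V)%type -> R) z v :
  'D_v h z = derive1 (fun s : R => h (s *: v + z)) 0.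
Proof.
rewrite derive1E; apply: derive_same_line => s.
by rewrite [s *: 1]mulr1 addr0.
Qed.

Lemma derive1_near_scale (f g : R -> R) c : derivable g 0 1 ->
  (\forall s \near (0 : R), f s = c * g s) -> derive1 f 0 = c * derive1 g 0.
Proof.
move=> dg fg; rewrite !derive1E.
rewrite (@near_eq_derive _ _ _ f (fun s => c * g s) 0 1 fg).
exact: deriveMl.
Qed.

Lemma derivable_line (h : (V * V)%type -> R) z v : derivable h z v ->
  derivable (fun s : R => h (s *: v + z)) 0 1.
Proof. by move=> /derivable1P. Qed.

Lemma homogeneous_derive_x d h u : smooth_on Dom h -> homogeneous d h ->
  homogeneous d ('D_(u, 0) h).
Proof.
move=> sh hh x y t Dz t0; rewrite !derive_line.
apply: derive1_near_scale; first by apply: derivable_line; exact: smooth_on_derivable sh Dz.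
have := Dom_line (u, 0) Dz; apply: filterS => s.
rewrite -[X in Dom X]/(_, _) -[X in h X]/(_, _) -[X in _ * h X]/(_, _) /=.
by rewrite scaler0 !add0r => Dz'; exact: hh.
Qed.

(** One factor [t] goes into the direction: differentiating along [t *: u] at [t *: y] is
    differentiating [h (x, t *: (y + s *: u))] in [s]. *)
Lemma homogeneous_derive_y d h u : smooth_on Dom h -> homogeneous d.+1 h ->
  homogeneous d ('D_(0, u) h).
Proof.
move=> sh hh x y t Dz t0.
have dh := smooth_on_differentiable fdVV oD sh (Dom_scale Dz t0).
have tN0 : t != 0 by rewrite gt_eqF.
apply: (mulfI tN0).
have -> : t * 'D_(0, u) h (x, t *: y) = 'D_(0, t *: u) h (x, t *: y).
  have -> : ((0, t *: u) : (V * V)%type) = t *: (0, u).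
    by rewrite -[RHS]/(_ *: _, _ *: _) scaler0.
  by rewrite !deriveE// linearZ.
rewrite mulrA -exprS !derive_line.
apply: derive1_near_scale; first by apply: derivable_line; exact: smooth_on_derivable sh Dz.
have := Dom_line (0, u) Dz; apply: filterS => s.
rewrite -[X in Dom X]/(_, _) -[X in h X]/(_, _) -[X in _ * h X]/(_, _) /=.
rewrite scaler0 !add0r => Dz'; rewrite -(hh _ _ _ Dz')//.
by rewrite scalerDr !scalerA mulrC.
Qed.

Lemma Euler_identity d h (x y : V) : smooth_on Dom h -> homogeneous d h -> Dom (x, y) ->
  \sum_j y 0 j * 'D_(eY j) h (x, y) = d%:R * h (x, y).
Proof.
move=> sh hh Dz.
have := derive_lin 0 y sh Dz.
rewrite [X in X + _]big1 ?add0r; last by move=> i _; rewrite mxE mul0r.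
move=> <-; rewrite derive_line [RHS]mulrC.
(* The point is [(x, (1 + s) *: y)]; homogeneity holds for positive factors only, hence the
   restriction to [-1 < s]. *)
have E : \forall s \near (0 : R), h (s *: (0, y) + (x, y)) = h (x, y) * ((1 + s) ^+ d).
  have : \forall s \near (0 : R), -1 < s by apply: lt_nbhsr; rewrite ltrN10.
  apply: filterS => s s1; rewrite mulrC -hh//; last by rewrite -ltrBlDl sub0r.
  by rewrite -[X in h X = _]/(_, _) /= scaler0 add0r scalerDl scale1r addrC.
have D : is_derive (0 : R) 1 (fun s : R => (1 + s) ^+ d) d%:R.
  have H : is_derive (0 : R) 1 (cst 1 + id : R -> R) (0 + 1) by apply: is_deriveD.
  have := is_deriveX d H; rewrite !fctE /= => H'; apply: is_derive_eq H' _.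
  by rewrite addr0 expr1n mulr1 add0r -[LHS]/(_ * _) mulr1.
by rewrite (derive1_near_scale _ E)// derive1E derive_val.
Qed.

(** Euler's identity for a second derivative of [Q]. It is used with [d = 0] for vertical [w], where
    it says that the Cartan tensor is annihilated by y, and with [d = 1] for [w] in the
    x-directions. *)
Lemma metric_contract d w s (x y : V) : Dom (x, y) -> homogeneous d ('D_w ('D_(eY s) Q)) ->
  \sum_j 'D_w (metric_fun s j) (x, y) * y 0 j =
  d%:R * (2^-1 * 'D_w ('D_(eY s) Q) (x, y)).
Proof.
move=> Dz hw; rewrite mulrCA -(Euler_identity (smooth_on_derive _ (smooth_on_derive _ sQ)) hw Dz).
rewrite mulr_sumr; apply: eq_bigr => j _.
have E := etrans (derive_metric_fun w s j Dz) (congr1 ( *%R 2^-1) (derive_comm3 (eY s) (eY j) w Dz)).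
by apply: etrans (congr1 ( *%R^~ (y 0 j)) E) _; rewrite -mulrA [y 0 j * _]mulrC.
Qed.

Lemma horizontal_metricE k i j (x y : V) : horizontal L k (metric L i j) x y =
  'D_(eX k) (metric_fun i j) (x, y) -
  \sum_m nonlinear_connection L m k x y * 'D_(eY m) (metric_fun i j) (x, y).
Proof.
apply: (congr2 (fun a b : R => a - b) (dx_metric k i j x y)).
by apply: eq_bigr => m _; exact: congr1 (dy_metric m i j x y).
Qed.

(** Each vertical derivative falls under [metric_contract] in degree 0, so [nonlinear_connection] is
    multiplied by zero whatever its value. *)
Lemma horizontal_metric_contract k s (x y : V) : Dom (x, y) ->
  \sum_j horizontal L k (metric L s j) x y * y 0 j =
  2^-1 * 'D_(eX k) ('D_(eY s) Q) (x, y).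
Proof.
move=> Dz.
have hY : homogeneous 1 ('D_(eY s) Q) := homogeneous_derive_y 'e_s sQ homogeneous_energy.
have hXY := homogeneous_derive_x 'e_k (smooth_on_derive (eY s) sQ) hY.
have hYY m := homogeneous_derive_y 'e_m (smooth_on_derive (eY s) sQ) hY.
have := metric_contract Dz hXY; rewrite mul1r => <-.
apply: etrans (_ : \sum_j ('D_(eX k) (metric_fun s j) (x, y) * y 0 j -
   \sum_m nonlinear_connection L m k x y * ('D_(eY m) (metric_fun s j) (x, y) * y 0 j)) = _).
  apply: eq_bigr => j _; rewrite horizontal_metricE mulrBl mulr_suml.
  by under eq_bigr do rewrite -mulrA.
rewrite sumrB exchange_big /= [X in _ - X]big1 ?subr0// => m _.
by rewrite -mulr_sumr (metric_contract Dz (hYY m)) mul0r mulr0.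
Qed.

Lemma horizontal_metric_sym k i j (x y : V) : Dom (x, y) ->
  horizontal L k (metric L i j) x y = horizontal L k (metric L j i) x y.
Proof.
move=> Dz; have E w : 'D_w (metric_fun i j) (x, y) = 'D_w (metric_fun j i) (x, y).
  apply: near_eq_derive; have := open_nbhs_nbhs (conj oD Dz).
  by apply: filterS => z Dz'; exact: metric_fun_sym.
apply: etrans (horizontal_metricE k i j x y) _.
apply: etrans _ (esym (horizontal_metricE k j i x y)).
apply: (congr2 (fun a b : R => a - b) (E (eX k))); apply: eq_bigr => m _.
exact: congr1 (E (eY m)).
Qed.

(** The right-hand side is the classical spray coefficient 2 G^i. Of the three terms of [chern], the
    first and the last have equal contractions, by symmetry of the metric, and the middle one
    reduces to an x-derivative of [Q]. *)
Lemma chern_contract i (x y : V) : Dom (x, y) ->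
  \sum_j \sum_k chern L i j k x y * y 0 j * y 0 k =
  2^-1 * \sum_s metric_inv L i s x y *
    (\sum_k y 0 k * 'D_(eX k) ('D_(eY s) Q) (x, y) - 'D_(eX s) Q (x, y)).
Proof.
move=> Dz.
have -> : \sum_j \sum_k chern L i j k x y * y 0 j * y 0 k =
    2^-1 * \sum_s metric_inv L i s x y * \sum_j \sum_k
     (horizontal L k (metric L s j) x y - horizontal L s (metric L j k) x y
     + horizontal L j (metric L k s) x y) * y 0 j * y 0 k.
  rewrite mulr_sumr; under [RHS]eq_bigr do rewrite !mulr_sumr.
  rewrite [RHS]exchange_big /=; apply: eq_bigr => j _.
  under [RHS]eq_bigr do rewrite !mulr_sumr.
  rewrite [RHS]exchange_big /=; apply: eq_bigr => k _.
  by rewrite /chern mulr_sumr !mulr_suml; apply: eq_bigr => s _; rewrite -!mulrA.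
congr (_ * _); apply: eq_bigr => s _; congr (_ * _).
have A1 : \sum_j \sum_k horizontal L k (metric L s j) x y * y 0 j * y 0 k =
    2^-1 * \sum_k y 0 k * 'D_(eX k) ('D_(eY s) Q) (x, y).
  rewrite exchange_big /= mulr_sumr; apply: eq_bigr => k _.
  by rewrite -mulr_suml horizontal_metric_contract// -mulrA [_ * y 0 k]mulrC.
have A2 : \sum_j \sum_k horizontal L j (metric L k s) x y * y 0 j * y 0 k =
    2^-1 * \sum_k y 0 k * 'D_(eX k) ('D_(eY s) Q) (x, y).
  apply: etrans _ A1; apply: etrans (exchange_big_dep xpredT _) _ => //=.
  apply: eq_bigr => j _; apply: eq_bigr => k _.
  apply: etrans (congr1 (fun r => r * y 0 k * y 0 j) (horizontal_metric_sym k j s Dz)) _.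
  by rewrite mulrAC.
have A3 : \sum_j \sum_k horizontal L s (metric L j k) x y * y 0 j * y 0 k =
    'D_(eX s) Q (x, y).
  apply: etrans (_ : \sum_j y 0 j * (2^-1 * 'D_(eX s) ('D_(eY j) Q) (x, y)) = _).
    apply: eq_bigr => j _; apply: etrans _ (congr1 ( *%R (y 0 j)) (horizontal_metric_contract s j Dz)).
    rewrite mulr_sumr.
    by apply: eq_bigr => k _; rewrite mulrA [y 0 j * _]mulrC.
  (* An x-derivative of [Q] still has degree 2 in y, so Euler's identity doubles it and absorbs the
     factor 1/2. *)
  have hX := homogeneous_derive_x 'e_s sQ homogeneous_energy.
  rewrite -[RHS](mulKf (_ : 2 != 0 :> R)) ?pnatr_eq0//.
  rewrite -(Euler_identity (smooth_on_derive _ sQ) hX Dz) mulr_sumr.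
  apply: eq_bigr => j _; rewrite mulrCA.
  exact: (congr1 (fun r => 2^-1 * (y 0 j * r)) (derive_comm (eY j) (eX s) oD sQ Dz)).
apply: etrans (sum_contract3 y (fun j k => horizontal L k (metric L s j) x y)
  (fun j k => horizontal L s (metric L j k) x y)
  (fun j k => horizontal L j (metric L k s) x y)) _.
apply: etrans (congr2 +%R (congr2 (fun p q => p - q) A1 A3) A2) _.
exact: half_sum.
Qed.

(** A row vector [u] killed by the matrix would satisfy g_y(u,u) = 0, against positive
    definiteness. *)
Lemma metric_unitmx (x y : V) : Dom (x, y) ->
  \matrix_(k, l) metric L k l x y \in unitmx.
Proof.
move=> Dz; rewrite -row_free_unit; apply: inj_row_free => u uM.
apply/eqP/negPn/negP => u0; have := posL Dz.1 Dz.2 u0.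
rewrite fundamental_formE /=.
have sD v : smooth_on Dom ('D_v Q) := smooth_on_derive v sQ.
rewrite (derive_lin _ _ (sD _) Dz) [X in X + _]big1 ?add0r; last by move=> i _; rewrite mxE mul0r.
suff -> : \sum_i u 0 i * 'D_(eY i) ('D_(0, u) Q) (x, y) = 0 by rewrite mulr0 ltxx.
have E i : 'D_(eY i) ('D_(0, u) Q) (x, y) = \sum_j u 0 j * 'D_(eY j) ('D_(eY i) Q) (x, y).
  rewrite (derive_comm _ _ oD sQ Dz) (derive_lin _ _ (sD _) Dz).
  by rewrite [X in X + _]big1 ?add0r// => k _; rewrite mxE mul0r.
apply: big1 => i _; rewrite E.
have := congr1 (fun m : 'rV_n => m 0 i) uM; rewrite !mxE.
under eq_bigr do rewrite mxE metricE /metric_fun mulrCA.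
rewrite -mulr_sumr => /eqP; rewrite mulf_eq0 invr_eq0 pnatr_eq0 /= => /eqP ->.
by rewrite mulr0.
Qed.

(** The time derivative of the momentum is the sum of y^k Q_{x^k y^s} and 2 g_{sl} x''^l. The
    equation thus identifies the bracket in [chern_contract] with -2 g x'', and the inverse metric
    recovers -x''. *)
Lemma Euler_Lagrange_geodesic (x : R -> V) (t : R) :
  derivable x t 1 -> derivable (derive1 x) t 1 -> O (x t) -> derive1 x t != 0 ->
  (forall s, derive1 (fun r => 'D_(eY s) Q (x r, derive1 x r)) t =
             'D_(eX s) Q (x t, derive1 x t)) ->
  covariant_acceleration L x t = 0.
Proof.
move=> dx1 dx2 Ox x'0 EL; set y := derive1 x t; have Dz : Dom (x t, y) by [].
apply/rowP => i; rewrite !mxE -/y chern_contract//.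
set x2 := derive1n 2 x t.
have sD v : smooth_on Dom ('D_v Q) := smooth_on_derive v sQ.
have E s : \sum_k y 0 k * 'D_(eX k) ('D_(eY s) Q) (x t, y) - 'D_(eX s) Q (x t, y) =
    - (2 * \sum_l metric L s l (x t) y * x2 0 l).
  have dh := smooth_on_differentiable fdVV oD (sD (eY s)) Dz.
  have dp : is_derive t 1 (fun r => (x r, derive1 x r)) (y, x2).
    by apply: is_derive_pair; [move: dx1|move: dx2] => /derivableP; rewrite -derive1E.
  have D1 := etrans (derive1E _ _) (@derive_val _ _ _ _ _ _ _ (is_derive_comp dp dh)).
  have EL' := etrans (esym (EL s)) (etrans D1 (derive_lin y x2 (sD (eY s)) Dz)).
  apply: etrans (congr1 (fun r => _ - r) EL') _.
  rewrite opprD addrA subrr add0r mulr_sumr; congr (- _).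
  apply: eq_bigr => l _.
  have G := etrans (metricE s l (x t) y) (metric_fun_sym s l Dz).
  apply: etrans (mul_half_double _ _) (congr1 (fun r => 2 * (r * x2 0 l)) (esym G)).
under eq_bigr do rewrite E mulrN mulrCA.
rewrite sumrN -mulr_sumr mulrN mulKf ?pnatr_eq0//.
apply/eqP; rewrite subr_eq0; apply/eqP; rewrite /metric_inv.
set M := \matrix_(k, l) metric L k l (x t) y.
have MV := mulVmx (metric_unitmx Dz).
have := congr1 (fun N => (N *m x2^T) i 0) MV; rewrite -mulmxA mul1mx [RHS]mxE => <-.
rewrite mxE; apply: eq_bigr => s _; congr (_ * _).
by rewrite mxE; apply: eq_bigr => l _; rewrite !mxE.
Qed.

End EulerLagrange.

(** * Flows of isometries *)

Lemma sum_delta_row (R : realType) n (s : 'I_n) (f : 'I_n -> R) :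
  \sum_i (delta_mx 0 s : 'rV[R]_n) 0 i * f i = f s.
Proof.
rewrite (bigD1 s)//= big1 ?addr0 ?mxE ?eqxx ?mul1r// => i /negPf is0.
by rewrite mxE is0 mul0r.
Qed.

Section FlowGeodesic.
Variables (R : realType) (n : nat) (L : 'rV[R]_n -> 'rV[R]_n -> R) (O : set 'rV[R]_n).
Local Notation V := 'rV[R]_n.
Hypothesis oO : open O.
Let Dom : set (V * V) := [set z | O z.1 /\ z.2 != 0].
Hypothesis sL : @smooth_on R (V * V)%type R Dom (fun z => L z.1 z.2).
Hypothesis homL : forall (x y : V) (t : R), O x -> 0 <= t -> L x (t *: y) = t * L x y.
Hypothesis posL : forall x y u : V, O x -> y != 0 -> u != 0 ->
  0 < fundamental_form (L x) y u u.

(** In use, [m] is the group law in charts, [w0] the coordinates of the identity, and [z] and [x]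
    one and the same one-parameter subgroup, read near time 0 and near time [t0]. *)
Variables (P : set (V * V)) (m : (V * V)%type -> V) (w0 : V).
Hypothesis oP : open P.
Hypothesis sm : smooth_on P m.
Hypothesis unitP : forall x, O x -> P (w0, x) /\ m (w0, x) = x.

Variables (x z : R -> V) (t0 : R) (Z : V).
Hypothesis z0 : z 0 = w0.
Hypothesis dz : is_derive (0 : R) 1 z Z.
Hypothesis cx : {for t0, continuous x}.
Hypothesis Ox0 : O (x t0).
(** The two orders of the neighbourhoods serve different derivatives: in [s] at each fixed [r], for
    the velocity of [x]; in [r] at each fixed [s], for the transport of that velocity. *)
Hypothesis flow1 : \forall r \near t0, \forall s \near (0 : R), x (s + r) = m (z s, x r).
Hypothesis flow2 : \forall s \near (0 : R), \forall r \near t0, x (s + r) = m (z s, x r).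

Let xi (x : V) : V := 'D_(Z, 0) m (w0, x).
Local Notation Q := (energy L).
Local Notation "'e_ i" := (delta_mx 0 i : V) (at level 8, i at level 2).
Local Notation eX i := (('e_i, 0) : (V * V)%type).
Local Notation eY i := ((0, 'e_i) : (V * V)%type).

Hypothesis xi_neq0 : xi (x t0) != 0.
Hypothesis critical : forall v : V, 'D_v (fun x => Q (x, xi x)) (x t0) = 0.
Hypothesis invariant : \forall s \near (0 : R), forall y : V,
  Q (m (z s, x t0), 'D_(0, y) m (z s, x t0)) = Q (x t0, y).

Let fdVV : fin_dim (V * V)%type := fin_dim_prod (fin_dim_rV R n) (fin_dim_rV R n).
Let oD : open Dom := slit_open oO.
Let sQ : smooth_on Dom Q := smooth_energy oO sL.

Let dm p : P p -> differentiable m p.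
Proof. by move=> Pp; exact: smooth_on_row_differentiable fdVV oP sm Pp. Qed.

Let sxi : smooth_on [set x | P (w0, x)] xi.
Proof. exact: smooth_on_slice (smooth_on_derive (Z, 0) sm). Qed.

Let oPw : open [set x | P (w0, x)].
Proof.
rewrite openE => y Py.
have : {for y, continuous (fun y => (w0, y))}.
  by apply: continuous_pair; [exact: cst_continuous|exact: (@cvg_id)].
by move=> cy; exact: (cy _ (open_nbhs_nbhs (conj oP Py))).
Qed.

Let dxi y : O y -> differentiable xi y.
Proof.
by move=> /unitP[Py _]; exact: smooth_on_row_differentiable (fin_dim_rV R n) oPw sxi Py.
Qed.

Let near_O : \forall r \near t0, O (x r).
Proof. exact: (cx (open_nbhs_nbhs (conj oO Ox0))). Qed.

Let dx : \forall r \near t0, is_derive (r : R) 1 x (xi (x r)).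
Proof.
near=> r; have Or : O (x r) by near: r.
have [Pr mr] := unitP Or.
have H : is_derive (0 : R) 1 (fun s => m (z s, x r)) (xi (x r)).
  have dp : is_derive (0 : R) 1 (fun s => (z s, x r)) (Z, 0).
    by apply: is_derive_pair => //; exact: is_derive_cst.
  by have := @is_derive_comp _ _ _ _ _ m _ _ _ dp; rewrite z0; apply; exact: dm.
have {}H : is_derive (0 : R) 1 (fun s => x (s + r)) (xi (x r)).
  apply: near_eq_is_derive H.
  by have : \forall s \near (0 : R), x (s + r) = m (z s, x r) by [near: r]; apply: filterS.
by apply: (is_derive_same_line _ _).1 H => h; rewrite addr0.
Unshelve. all: by end_near. Qed.

Let x' : \forall r \near t0, derive1 x r = xi (x r).
Proof. by apply: filterS dx => r [_ <-]; rewrite derive1E. Qed.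

Let x't0 : derive1 x t0 = xi (x t0) := nbhs_singleton x'.

Let dx0 : is_derive t0 1 x (xi (x t0)) := nbhs_singleton dx.

Let dx' : is_derive t0 1 (derive1 x) ('D_(xi (x t0)) xi (x t0)).
Proof.
have := is_derive_comp dx0 (dxi Ox0); apply: near_eq_is_derive.
by apply: filterS x' => r ->.
Qed.

Let near_z (A : set (V * V)) : open A -> A (w0, x t0) -> \forall s \near (0 : R), A (z s, x t0).
Proof.
move=> oA Aw.
have : {for (0 : R), continuous (fun s => (z s, x t0))}.
  apply: continuous_pair; last exact: cst_continuous.
  by apply/differentiable_continuous/derivable1_diffP; case: dz.
move=> /(_ A); rewrite z0; apply; exact: open_nbhs_nbhs.
Qed.

(* The coordinate vector e_s at x t0 carried along the curve by the flow. *)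
Let W (s : 'I_n) (r : R) : V := 'D_(0, 'e_s) m (z r, x t0).

Let W0 s : W s 0 = 'e_s.
Proof.
rewrite /W z0 -derive_slice.
apply: etrans (_ : 'D_('e_s) id (x t0) = _); last by rewrite derive_id.
apply: near_eq_derive; have := open_nbhs_nbhs (conj oO Ox0).
by apply: filterS => y /unitP[].
Qed.

(** Mixed derivatives of [m] commute: differentiating the transported vector in time is
    differentiating the generating field [xi] in space. *)
Let dW s : is_derive (0 : R) 1 (W s) ('D_('e_s) xi (x t0)).
Proof.
have [Pw _] := unitP Ox0.
have dp : is_derive (0 : R) 1 (fun s => (z s, x t0)) (Z, 0).
  by apply: is_derive_pair => //; exact: is_derive_cst.
have dDm : differentiable ('D_(0, 'e_s) m) (z 0, x t0).
  rewrite z0; exact: smooth_on_row_differentiable fdVV oP (smooth_on_derive _ sm) Pw.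
apply: is_derive_eq (is_derive_comp dp dDm) _; rewrite z0.
apply: etrans (derive_row_comm (0, 'e_s) (Z, 0) oP sm Pw) _.
by rewrite -derive_slice.
Qed.

Let p (l : 'I_n) (r : R) := 'D_(eY l) Q (x r, derive1 x r).

Let Dom0 : Dom (x t0, xi (x t0)).
Proof. by []. Qed.

Let derivable_p l : derivable (p l) t0 1.
Proof.
have dp := is_derive_pair dx0 dx'.
have dh : differentiable ('D_(eY l) Q) (x t0, derive1 x t0).
  rewrite x't0.
  exact: smooth_on_differentiable fdVV oD (smooth_on_derive (eY l) sQ) Dom0.
by have [] := is_derive_comp dp dh.
Qed.

Let momentum s : \forall r \near (0 : R), \sum_l W s r 0 l * p l (r + t0) = p s t0.
Proof.
have cx' : {for t0, continuous (derive1 x)}.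
  by apply/differentiable_continuous/derivable1_diffP; case: dx'.
have nD : \forall r \near (0 : R), Dom (x (r + t0), derive1 x (r + t0)).
  have : {for (0 : R), continuous (fun r => (x (r + t0), derive1 x (r + t0)))}.
    have sh (U : topologicalType) (f : R -> U) : {for t0, continuous f} ->
        {for (0 : R), continuous (fun r => f (r + t0))}.
      move=> cf; apply: (@continuous_comp _ _ _ (fun r => r + t0) f).
        by apply: cvgD; [exact: cvg_id|exact: cvg_cst].
      by rewrite add0r.
    by apply: continuous_pair; apply: sh.
  move=> /(_ Dom); rewrite add0r x't0; apply; exact: open_nbhs_nbhs.
have [Pw _] := unitP Ox0.
have nP := near_z oP Pw.
near=> r.
have Dr : Dom (x (r + t0), derive1 x (r + t0)) by near: r.
have Pr : P (z r, x t0) by near: r.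
have fl : \forall q \near t0, x (r + q) = m (z r, x q) by near: r; exact: flow2.
have inv : forall y : V, Q (m (z r, x t0), 'D_(0, y) m (z r, x t0)) = Q (x t0, y).
  by near: r; exact: invariant.
have xr : x (r + t0) = m (z r, x t0) := nbhs_singleton fl.
(* Differentiating [x (r + q) = m (z r, x q)] in [q]: the velocity of the curve is itself carried
   along by the flow, so the invariance of [Q] can be used at this vector. *)
have x'r : derive1 x (r + t0) = 'D_(0, xi (x t0)) m (z r, x t0).
  rewrite derive1E.
  apply: etrans (_ : 'D_1 (fun q => x (r + q)) t0 = _).
    by apply: derive_same_line => h; rewrite addrCA.
  apply: etrans (near_eq_derive _ fl) _.
  have dp : is_derive t0 1 (fun q => (z r, x q)) (0, xi (x t0)).
    by apply: is_derive_pair; [exact: is_derive_cst|exact: dx0].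
  exact: (@derive_val _ _ _ _ _ _ _ (is_derive_comp dp (dm Pr))).
have lin (y : V) (h : R) : 'D_(0, h *: 'e_s + y) m (z r, x t0) =
    h *: W s r + 'D_(0, y) m (z r, x t0).
  have -> : ((0, h *: 'e_s + y) : (V * V)%type) = h *: (0, 'e_s) + (0, y).
    by rewrite -[RHS]/(h *: 0 + 0, _) scaler0 addr0.
  have d := dm Pr.
  apply: etrans (deriveE _ d) _; apply: etrans (linearP _ _ _ _) _.
  by rewrite /W (deriveE _ d) (deriveE (0, y) d).
(* The invariance is differentiated along a vertical line in the direction of the s-th coordinate
   vector, whose image has direction [W s r]. *)
have E : 'D_(0, W s r) Q (x (r + t0), derive1 x (r + t0)) = p s t0.
  rewrite /p x't0 x'r xr.
  apply: derive_same_line => h.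
  rewrite -[X in Q X = _]/(h *: 0 + _, h *: W s r + _) -lin scaler0 add0r inv.
  by rewrite -[X in _ = Q X]/(h *: 0 + _, _) scaler0 add0r.
rewrite -E; apply: etrans _ (esym (derive_lin oO _ _ sQ Dr)).
apply: etrans (esym (add0r _)) _; apply: (congr2 +%R); last by [].
by apply/esym; apply: big1 => i _; rewrite mxE mul0r.
Unshelve. all: by end_near. Qed.

Lemma flow_geodesic : covariant_acceleration L x t0 = 0.
Proof.
apply: (Euler_Lagrange_geodesic oO sL homL posL) => //.
- by case: dx0.
- by case: dx'.
- by rewrite x't0.
move=> s; rewrite x't0.
pose W' : V := 'D_('e_s) xi (x t0).
have dp l : is_derive (0 : R) 1 (fun r => p l (r + t0)) (derive1 (p l) t0).
  apply: is_derive_translate; rewrite add0r derive1E; exact/derivableP/derivable_p.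
have dWl l : is_derive (0 : R) 1 (fun r => W s r 0 l) (W' 0 l).
  exact: is_derive_row (dW s).
have dsum : is_derive (0 : R) 1 (\sum_l (fun r => W s r 0 l) * (fun r => p l (r + t0)))
    (\sum_l (W s 0 0 l *: derive1 (p l) t0 + p l (0 + t0) *: W' 0 l)).
  by apply: is_derive_sum => l; exact: is_deriveM.
(* The momentum is constant near 0. Since [W s] starts at the coordinate vector, the Leibniz rule
   leaves the derivative of [p s] and a term in the derivative of [xi], which [critical] converts
   into an x-derivative of [Q]. *)
have H : 'D_1 (\sum_l (fun r => W s r 0 l) * (fun r => p l (r + t0))) (0 : R) = 0.
  apply: etrans (_ : 'D_1 (cst (p s t0)) (0 : R) = _); last by rewrite derive_cst.
  by apply: near_eq_derive; apply: filterS (momentum s) => r; rewrite fct_sumE.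
move: H; rewrite (@derive_val _ _ _ _ _ _ _ dsum) W0 add0r big_split /=.
rewrite (bigD1 s)//= big1 ?addr0; last first.
  by move=> l ls; rewrite mxE eqxx (negPf ls) scale0r.
rewrite mxE !eqxx scale1r => /eqP; rewrite addr_eq0 => /eqP H.
have dQ := smooth_on_differentiable fdVV oD sQ Dom0.
have dpair := is_derive_graph 'e_s (dxi Ox0).
have C := etrans (esym (derive_lin oO 'e_s W' sQ Dom0))
  (etrans (esym (@derive_val _ _ _ _ _ _ _ (is_derive_comp dpair dQ))) (critical 'e_s)).
have {}C := etrans (congr2 +%R (esym (sum_delta_row s _)) erefl) C.
apply: etrans H _; apply: etrans _ (addr0_eq (etrans (addrC _ _) C)).
apply: (congr1 -%R); apply: eq_bigr => l _; apply: etrans (mulrC _ _) _.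
exact: (congr1 (fun y => W' 0 l * 'D_(eY l) Q (x t0, y)) x't0).
Qed.

End FlowGeodesic.

(** * Curves in charts *)

Lemma derive_local_max (R : realType) (f : R -> R) (df : R) :
  is_derive (0 : R) 1 f df -> (\forall h \near (0 : R), f h <= f 0) -> df = 0.
Proof.
move=> [dfc <-] fmax.
have cv : h^-1 * (f h - f 0) @[h --> (0 : R)^'] --> 'D_1 f 0.
  have -> : (fun h : R => h^-1 * (f h - f 0)) =
            (fun h => h^-1 *: ((f \o shift 0) (h *: 1) - f 0)).
    by apply/funext => h /=; rewrite [h *: 1]mulr1 addr0.
  exact: dfc.
have pt (P : R -> Prop) : (\forall h \near (0 : R)^', P h) ->
    exists2 e : R, 0 < e & [/\ P e, P (- e), f e <= f 0 & f (- e) <= f 0].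
  move=> nP; have : \forall h \near (0 : R)^', P h /\ f h <= f 0.
    by apply: filterI => //; exact: nbhs_dnbhs.
  move=> [e /= e0 be]; have e2 : 0 < e / 2 by rewrite divr_gt0.
  have e2e : e / 2 < e by rewrite ltr_pdivrMr// mulr_natr mulr2n ltrDl.
  have [] := be (e / 2); rewrite ?gt_eqF//= ?sub0r ?normrN ?gtr0_norm// => P1 f1.
  have [] := be (- (e / 2)); rewrite ?oppr_eq0 ?gt_eqF//= ?sub0r ?normrN ?gtr0_norm// => P2 f2.
  by exists (e / 2).
apply/eqP; rewrite eq_le; apply/andP; split; rewrite leNgt; apply/negP => d0.
  have [e e0 [+ _ fe _]] := pt _ (cvgr_gt _ cv _ d0).
  by rewrite ltNge mulr_ge0_le0// ?subr_le0// invr_ge0 ltW.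
have [e e0 [_ + _ fe]] := pt _ (cvgr_lt _ cv _ d0).
by rewrite ltNge mulr_le0// ?subr_le0// invr_le0 oppr_le0 ltW.
Qed.

Lemma near_continuous (X Y : topologicalType) (f : X -> Y) (x : X) (P : Y -> Prop) :
  {for x, continuous f} -> (\forall y \near f x, P y) -> \forall z \near x, P (f z).
Proof. exact. Qed.

Section Charts.
Variables (R : realType) (n : nat) (M : topologicalType) (A : atlas R n M).
Local Notation V := 'rV[R]_n.
Implicit Types a b : chart R n M.

Lemma cmap_cimg a p : cdom a p -> cimg a (cmap a p).
Proof. by move=> ap; exists p. Qed.

Lemma cinv_cdom a (x : V) : cimg a x -> cdom a (cinv a x).
Proof. by move=> [p ap <-]; rewrite cmapK. Qed.

Lemma cinvK a (x : V) : cimg a x -> cmap a (cinv a x) = x.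
Proof. by move=> [p ap <-]; rewrite cmapK. Qed.

Lemma near_cdom a (p : M) : cdom a p -> \forall q \near p, cdom a q.
Proof. by move=> ap; apply: open_nbhs_nbhs; split => //; exact: cdom_open. Qed.

Lemma near_cimg a (x : V) : cimg a x -> \forall y \near x, cimg a y.
Proof. by move=> ax; apply: open_nbhs_nbhs; split => //; exact: cimg_open. Qed.

Definition overlap a b := cimg a `&` cinv a @^-1` cdom b.

Lemma open_overlap a b : open (overlap a b).
Proof.
rewrite openE => x [ax bx].
apply: filterI; first exact: near_cimg.
exact: (cinv_continuous ax) _ (near_cdom bx).
Qed.

Lemma transition_differentiable a b x : charts A a -> charts A b -> overlap a b x ->
  differentiable (cmap b \o cinv a) x.
Proof.
move=> Aa Ab abx.
have sm : smooth_on (overlap a b) (cmap b \o cinv a) := charts_compatible Aa Ab.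
exact: smooth_on_row_differentiable (fin_dim_rV R n) (@open_overlap a b) sm abx.
Qed.

Lemma overlap_cmap a b p : cdom a p -> cdom b p -> overlap a b (cmap a p).
Proof. by move=> ap bp; split; [exact: cmap_cimg|rewrite /= cmapK]. Qed.

Lemma is_derive_change_chart a b (s : R -> M) (t : R) v :
  charts A a -> charts A b -> {for t, continuous s} -> cdom a (s t) -> cdom b (s t) ->
  is_derive t 1 (cmap a \o s) v ->
  is_derive t 1 (cmap b \o s) ('D_v (cmap b \o cinv a) (cmap a (s t))).
Proof.
move=> Aa Ab cs ast bst dv.
have df := transition_differentiable Aa Ab (overlap_cmap ast bst).
have := is_derive_comp dv df; apply: near_eq_is_derive.
by apply: filterS (near_continuous cs (near_cdom ast)) => r ar /=; rewrite cmapK.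
Qed.

Definition cderivable (s : R -> M) (t : R) := {for t, continuous s} /\
  derivable (cmap (chart_at A (s t)) \o s) t 1.

Lemma cderivableP a (s : R -> M) (t : R) : charts A a -> cdom a (s t) ->
  cderivable s t <-> {for t, continuous s} /\ derivable (cmap a \o s) t 1.
Proof.
move=> Aa ast; have Ab := chart_at_charts A (s t); have bst := chart_at_dom A (s t).
split=> -[cs /derivableP ds]; split=> //.
  by case: (is_derive_change_chart Ab Aa cs bst ast ds).
by case: (is_derive_change_chart Aa Ab cs ast bst ds).
Qed.

Definition speed (F : M -> V -> R) s t := F (s t) (velocity A s t).

Lemma speedE F a (s : R -> M) (t : R) v : charts A a -> cdom a (s t) -> {for t, continuous s} ->
  is_derive t 1 (cmap a \o s) v -> speed F s t = local_expr A F a (cmap a (s t)) v.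
Proof.
move=> Aa ast cs dv; rewrite /speed /local_expr /= cmapK// /velocity derive1E.
by have [_ ->] := is_derive_change_chart Aa (chart_at_charts A (s t)) cs ast (chart_at_dom A (s t)) dv.
Qed.

(** Straight lines in a chart realise every tangent vector as a velocity, so that statements about
    vectors can be derived from statements about speeds of curves. *)
Lemma chart_line_continuous a (x y : V) : cimg a x ->
  {for (0 : R), continuous (fun r : R => cinv a (x + r *: y))}.
Proof.
move=> ax; apply: (@continuous_comp _ _ _ (fun r : R => x + r *: y) (cinv a)).
  by apply: continuousD; [exact: cst_continuous|exact: scalel_continuous].
by rewrite scale0r addr0; exact: cinv_continuous.
Qed.

Lemma chart_line_derive a (x y : V) : cimg a x ->
  is_derive (0 : R) 1 (cmap a \o (fun r : R => cinv a (x + r *: y))) y.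
Proof.
move=> ax.
have H : is_derive (0 : R) 1 (fun r : R => x + r *: y) y.
  by apply: (is_derive_line (f := id)); exact: is_derive_id.
apply: near_eq_is_derive H.
have cl : {for (0 : R), continuous (fun r : R => x + r *: y)}.
  by apply: continuousD; [exact: cst_continuous|exact: scalel_continuous].
have : \forall r \near (0 : R), cimg a (x + r *: y).
  by apply: (near_continuous cl); rewrite scale0r addr0; exact: near_cimg.
by apply: filterS => r ar /=; rewrite cinvK.
Qed.

(** * Finsler metrics in charts *)

Section FinslerCharts.
Variables (F : M -> V -> R).
Hypothesis fF : is_finsler A F.

Lemma finsler0 p : F p 0 = 0.
Proof.
by have := finsler_homogeneous fF p 0 (lexx 0); rewrite scale0r mul0r.
Qed.

(** If F vanished at [y] it would vanish along the ray of [y], and then g_y(y,y) = 0. Positive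
    homogeneity reaches [y + s *: y] for [-1 < s], which is enough near 0. *)
Lemma finsler_gt0 p (y : V) : y != 0 -> 0 < F p y.
Proof.
move=> y0; rewrite lt_def (finsler_ge0 fF) andbT; apply/negP => /eqP Fy.
have := finsler_pos_def fF p y0 y0; rewrite /fundamental_form.
have Fs (s : R) : -1 < s -> F p (y + s *: y) = 0.
  move=> s1; rewrite -[X in X + _]scale1r -scalerDl (finsler_homogeneous fF) ?Fy ?mulr0//.
  rewrite -lerBlDl sub0r; exact: ltW.
have near1 (s : R) : -1 < s -> \forall t \near s, -1 < t by exact: lt_nbhsr.
have inner (s : R) : -1 < s -> derive1 (fun t : R => F p (y + s *: y + t *: y) ^+ 2) 0 = 0.
  move=> s1; rewrite derive1E.
  apply: etrans (_ : 'D_1 (cst 0 : R -> R) (0 : R) = _); last by rewrite derive_cst.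
  apply: near_eq_derive.
  have : \forall t \near (0 : R), - (1 + s) < t.
    by apply: lt_nbhsr; rewrite oppr_lt0 -ltrBlDl sub0r.
  apply: filterS => t ts; rewrite -addrA -scalerDl Fs ?expr0n//.
  lra.
suff -> : derive1 (fun s : R => derive1 (fun t : R => F p (y + s *: y + t *: y) ^+ 2) 0) 0 = 0.
  by rewrite mulr0 ltxx.
rewrite derive1E.
apply: etrans (_ : 'D_1 (cst 0 : R -> R) (0 : R) = _); last by rewrite derive_cst.
apply: near_eq_derive; have := near1 0; rewrite ltrN10 => /(_ isT).
by apply: filterS => s /inner.
Qed.

Section LocalExpr.
Variables (a : chart R n M) (Aa : charts A a).
Let T x y := 'D_y (cmap (chart_at A (cinv a x)) \o cinv a) x.

Let dT x : cimg a x -> differentiable (cmap (chart_at A (cinv a x)) \o cinv a) x.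
Proof.
move=> ax; apply: transition_differentiable => //; first exact: chart_at_charts.
by split => //; exact: chart_at_dom.
Qed.

Let T_lin x (c : R) u v : cimg a x -> T x (c *: u + v) = c *: T x u + T x v.
Proof. by move=> /dT d; rewrite /T !deriveE// linearP. Qed.

(** The reverse transition is a local inverse; by the chain rule a null vector of [T x] would be a
    null vector of the identity. *)
Let T_inj x y : cimg a x -> y != 0 -> T x y != 0.
Proof.
move=> ax; apply: contra_neq => Ty0.
set b := chart_at A (cinv a x) in Ty0.
have Ab : charts A b by exact: chart_at_charts.
have bx : cdom b (cinv a x) by exact: chart_at_dom.
have abx : overlap a b x by [].
have dl : is_derive x y (cmap b \o cinv a) (T x y).
  by apply/derivableP/diff_derivable; exact: dT.
have d2 : differentiable (cmap a \o cinv b) ((cmap b \o cinv a) x).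
  apply: transition_differentiable => //; apply: overlap_cmap => //.
  exact: cinv_cdom.
have [_ E] := is_derive_comp dl d2.
have : 'D_y (@idfun V) x = 0.
  rewrite -[RHS](derive0 (cmap a \o cinv b) ((cmap b \o cinv a) x)) -Ty0 -E.
  apply: near_eq_derive; have := open_nbhs_nbhs (conj (@open_overlap a b) abx).
  by apply: filterS => z [az bz] /=; rewrite cmapK// cinvK.
by rewrite derive_id.
Qed.

Lemma local_expr_homogeneous (x y : V) (t : R) : cimg a x -> 0 <= t ->
  local_expr A F a x (t *: y) = t * local_expr A F a x y.
Proof.
move=> ax t0; rewrite /local_expr -[in RHS](finsler_homogeneous fF)//; congr (F _ _).
have := T_lin t y 0 ax; rewrite !addr0 /T => ->.
by rewrite derive0 addr0.
Qed.

(** On a fiber, [local_expr] is F composed with the injective linear map [T x], so its fundamental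
    form is a pullback. *)
Lemma local_expr_pos_def (x y u : V) : cimg a x -> y != 0 -> u != 0 ->
  0 < fundamental_form (local_expr A F a x) y u u.
Proof.
move=> ax y0 u0.
have := finsler_pos_def fF (cinv a x) (T_inj ax y0) (T_inj ax u0).
rewrite /fundamental_form.
suff -> : (fun s : R => derive1 (fun t : R =>
    F (cinv a x) (T x y + s *: T x u + t *: T x u) ^+ 2) 0) =
  (fun s : R => derive1 (fun t : R => local_expr A F a x (y + s *: u + t *: u) ^+ 2) 0) by [].
apply/funext => s; congr (derive1 _ 0); apply/funext => t.
have E : T x (y + s *: u + t *: u) = T x y + s *: T x u + t *: T x u.
  have -> : y + s *: u + t *: u = t *: u + (s *: u + y) by rewrite addrC [y + _]addrC.
  apply: etrans (T_lin t u (s *: u + y) ax) _.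
  apply: etrans (congr1 (+%R (t *: T x u)) (T_lin s u y ax)) _.
  by move: (T x y) (T x u) => p q; rewrite addrC [s *: q + p]addrC.
exact: (congr1 (fun y => F (cinv a x) y ^+ 2) (esym E)).
Qed.

End LocalExpr.
End FinslerCharts.
End Charts.

(** * One-parameter subgroups and right-invariant fields *)

Section Lie.
Variables (R : realType) (n : nat) (G : topGroupType) (A : atlas R n G).
Hypothesis lieG : is_lie_group A.
Local Notation V := 'rV[R]_n.
Local Notation a1 := (chart_at A (1%g : G)).
Local Notation w0 := (cmap a1 1%g).

Let fdVV : fin_dim (V * V)%type := fin_dim_prod (fin_dim_rV R n) (fin_dim_rV R n).

Definition mul_chart (a b c : chart R n G) (z : (V * V)%type) : V :=
  cmap c (cinv a z.1 * cinv b z.2)%g.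

Definition mul_dom (a b c : chart R n G) : set (V * V) :=
  [set z | [/\ cimg a z.1, cimg b z.2 & cdom c (cinv a z.1 * cinv b z.2)%g]].

Lemma continuous_mul (T : topologicalType) (f g : T -> G) (x : T) :
  {for x, continuous f} -> {for x, continuous g} ->
  {for x, continuous (fun y => f y * g y)%g}.
Proof.
move=> cf cg.
apply: (@continuous_comp _ _ _ (fun y => (f y, g y)) (fun z : G * G => (z.1 * z.2)%g)).
  exact: continuous_pair.
exact: (lie_mul_continuous lieG).
Qed.

Lemma open_mul_dom a b c : open (mul_dom a b c).
Proof.
rewrite openE => z [az bz cz].
have c1 : {for z, continuous (fun z : V * V => cinv a z.1)}.
  by apply: (@continuous_comp _ _ _ fst (cinv a)); [exact: cvg_fst|exact: cinv_continuous].
have c2 : {for z, continuous (fun z : V * V => cinv b z.2)}.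
  by apply: (@continuous_comp _ _ _ snd (cinv b)); [exact: cvg_snd|exact: cinv_continuous].
have n1 : \forall y \near z, cimg a y.1.
  by apply: (near_continuous (f := fst)); [exact: cvg_fst|exact: near_cimg].
have n2 : \forall y \near z, cimg b y.2.
  by apply: (near_continuous (f := snd)); [exact: cvg_snd|exact: near_cimg].
have n3 := near_continuous (continuous_mul c1 c2) (near_cdom cz).
by apply: filterS3 n1 n2 n3 => y; split.
Qed.

Lemma smooth_mul_chart a b c : charts A a -> charts A b -> charts A c ->
  smooth_on (mul_dom a b c) (mul_chart a b c).
Proof. exact: (lie_mul_smooth lieG). Qed.

Lemma mul_chart_differentiable a b c z : charts A a -> charts A b -> charts A c ->
  mul_dom a b c z -> differentiable (mul_chart a b c) z.
Proof.
move=> Aa Ab Ac.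
exact: smooth_on_row_differentiable fdVV (@open_mul_dom a b c) (smooth_mul_chart Aa Ab Ac).
Qed.

Lemma mul_dom_cmap a b c p q : cdom a p -> cdom b q -> cdom c (p * q)%g ->
  mul_dom a b c (cmap a p, cmap b q).
Proof. by move=> ap bq cpq; split; rewrite ?cmapK//; exact: cmap_cimg. Qed.

Lemma is_derive_mul a b c (s u : R -> G) (t : R) v w :
  charts A a -> charts A b -> charts A c ->
  cdom a (s t) -> cdom b (u t) -> cdom c (s t * u t)%g ->
  {for t, continuous s} -> {for t, continuous u} ->
  is_derive t 1 (cmap a \o s) v -> is_derive t 1 (cmap b \o u) w ->
  is_derive t 1 (cmap c \o (fun r => s r * u r)%g)
    ('D_(v, w) (mul_chart a b c) (cmap a (s t), cmap b (u t))).
Proof.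
move=> Aa Ab Ac ast but cst cs cu ds du.
have df := mul_chart_differentiable Aa Ab Ac (mul_dom_cmap ast but cst).
have := is_derive_comp (is_derive_pair ds du) df.
apply: near_eq_is_derive.
apply: filterS2 (near_continuous cs (near_cdom ast)) (near_continuous cu (near_cdom but)).
by move=> r ar br; rewrite /mul_chart /= !cmapK.
Qed.

Lemma is_derive_cst_curve (a : chart R n G) (p : G) (t : R) :
  is_derive t 1 (cmap a \o (fun=> p)) 0.
Proof. exact: is_derive_cst. Qed.

Lemma cderivable_mul (s u : R -> G) (t : R) : cderivable A s t -> cderivable A u t ->
  cderivable A (fun r => s r * u r)%g t.
Proof.
move=> [cs /derivableP ds] [cu /derivableP du]; split; first exact: continuous_mul.
by have [] := is_derive_mul (chart_at_charts A _) (chart_at_charts A _)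
  (chart_at_charts A _) (chart_at_dom A _) (chart_at_dom A _) (chart_at_dom A _) cs cu ds du.
Qed.

Lemma cderivable_cst (p : G) (t : R) : cderivable A (fun=> p) t.
Proof.
split; first exact: cst_continuous.
by have [] := is_derive_cst_curve (chart_at A p) p t.
Qed.

(** * Left invariance read on curves *)

Section LeftInvariance.
Variable F : G -> V -> R.
Hypothesis invF : left_invariant A F.

(** Left translation by [g] is, in charts, a slice of the multiplication, hence differentiable; the
    chain rule then identifies [tdiff] of the velocity with the velocity of the translated curve. *)
Lemma speed_left (g : G) (s : R -> G) (t : R) : cderivable A s t ->
  speed A F (fun r => g * s r)%g t = speed A F s t.
Proof.
move=> [cs /derivableP ds]; rewrite /speed -[RHS](invF g); congr (F _ _).
set a := chart_at A (s t) in ds *; set b := chart_at A (g * s t)%g.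
have Aa : charts A a by exact: chart_at_charts.
have Ab : charts A b by exact: chart_at_charts.
pose d := chart_at A g.
have E : cmap b \o (fun q => g * q)%g \o cinv a = (fun x => mul_chart d a b (cmap d g, x)).
  by apply/funext => x; rewrite /mul_chart /= cmapK//; exact: chart_at_dom.
have D : mul_dom d a b (cmap d g, cmap a (s t)).
  by apply: mul_dom_cmap; exact: chart_at_dom.
have df : differentiable (fun x => mul_chart d a b (cmap d g, x)) (cmap a (s t)).
  apply: (@differentiable_comp _ _ _ _ (fun x => (cmap d g, x)) (mul_chart d a b)).
    exact: (differentiable_pair (differentiable_cst _ _)).
  by apply: mul_chart_differentiable D => //; exact: chart_at_charts.
rewrite /tdiff -/a -/b E /velocity !derive1E -/a -/b.
have [_ <-] := is_derive_comp ds df.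
apply: near_eq_derive.
apply: filterS (near_continuous cs (near_cdom (chart_at_dom A (s t)))) => r ar.
by rewrite /mul_chart /= !cmapK//; exact: chart_at_dom.
Qed.

End LeftInvariance.

(** Differentiability is asked at 0 only, which is what limits of powers can be shown to satisfy;
    [one_param_smooth] recovers smoothness. *)
Definition one_param (c : R -> G) := [/\ forall s t, c (s + t) = (c s * c t)%g,
  continuous c & derivable (cmap a1 \o c) 0 1].

Section OneParam.
Variable c : R -> G.
Hypothesis oc : one_param c.

Lemma one_paramD s t : c (s + t) = (c s * c t)%g. Proof. by case: oc. Qed.

Lemma one_param_continuous t : {for t, continuous c}.
Proof. by case: oc => _ cc _; exact: cc. Qed.

Lemma one_param0 : c 0 = 1%g.
Proof. by apply: (mulgI (c 0)); rewrite -one_paramD addr0 mulg1. Qed.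

Lemma one_paramC s t : (c s * c t)%g = (c t * c s)%g.
Proof. by rewrite -!one_paramD addrC. Qed.

Let Z := velocity A c 0.

Lemma one_param_derive : is_derive (0 : R) 1 (cmap a1 \o c) Z.
Proof.
case: oc => _ _ /derivableP; rewrite /Z /velocity derive1E.
by rewrite one_param0.
Qed.

Let a1_c0 : cdom a1 (c 0).
Proof. by rewrite one_param0; exact: chart_at_dom. Qed.

(** Right multiplication by [c t] carries time 0 to time [t]. *)
Lemma one_param_cderivable t : cderivable A c t.
Proof.
have H : cderivable A (fun r => c r * c t)%g 0.
  apply: cderivable_mul; last exact: cderivable_cst.
  apply/(cderivableP (chart_at_charts A 1%g) a1_c0).
  by split; [exact: one_param_continuous|case: oc].
split; first exact: one_param_continuous.
have [_] := H; rewrite one_param0 mul1g => /derivableP.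
have E h : (cmap (chart_at A (c t)) \o (fun r => c r * c t)%g) (h *: 1 + 0) =
           (cmap (chart_at A (c t)) \o c) (h *: 1 + t).
  by rewrite /= addr0 one_paramD.
by move=> /(is_derive_same_line _ E).1[].
Qed.

(* The right-invariant vector field generating left multiplication by c. *)
Definition right_field (a : chart R n G) (x : V) : V :=
  'D_(Z, 0) (mul_chart a1 a a) (w0, x).

Lemma mul_dom_unit a x : cimg a x ->
  mul_dom a1 a a (w0, x) /\ mul_chart a1 a a (w0, x) = x.
Proof.
move=> ax; have E : cinv a1 w0 = 1%g by rewrite cmapK//; exact: chart_at_dom.
rewrite /mul_chart /mul_dom /= E mul1g cinvK//; split => //; split => //.
  by apply: cmap_cimg; exact: chart_at_dom.
exact: cinv_cdom.
Qed.

Lemma smooth_right_field a : charts A a -> smooth_on (cimg a) (right_field a).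
Proof.
move=> Aa k.
have A1 := chart_at_charts A (1%g : G).
have := smooth_on_slice w0 (smooth_on_derive (Z, 0) (smooth_mul_chart A1 Aa Aa)).
move=> /(_ k); apply: Ck_on_sub => x /mul_dom_unit[]; exact.
Qed.

Lemma is_derive_flow a p : charts A a -> cdom a p ->
  is_derive (0 : R) 1 (cmap a \o (fun r => c r * p)%g) (right_field a (cmap a p)).
Proof.
move=> Aa ap.
have cp : cdom a (c 0 * p)%g by rewrite one_param0 mul1g.
have := is_derive_mul (chart_at_charts A 1%g) Aa Aa a1_c0 (ap : cdom a ((fun=> p) 0)) cp
  (@one_param_continuous 0) (@cst_continuous _ _ p (0 : R)) one_param_derive (is_derive_cst_curve a p 0).
by rewrite /right_field /= one_param0.
Qed.

Lemma one_param_ode a t : charts A a -> cdom a (c t) ->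
  is_derive t 1 (cmap a \o c) (right_field a (cmap a (c t))).
Proof.
move=> Aa act; have := is_derive_flow Aa act.
have E h : (cmap a \o (fun r => c r * c t)%g) (h *: 1 + 0) = (cmap a \o c) (h *: 1 + t).
  by rewrite /= addr0 one_paramD.
by move=> /(is_derive_same_line _ E).1.
Qed.

(** Bootstrap on [one_param_ode]: the field is smooth, so if [c] is C^k then its derivative is C^k
    as well. *)
Lemma one_param_smooth : smooth_map A c.
Proof.
split; first by move=> t; exact: one_param_continuous.
move=> a Aa; set U := c @^-1` cdom a.
have oU : open U.
  by apply: open_comp (@cdom_open _ _ _ a) => t _; exact: one_param_continuous.
have cx t : U t -> {for t, continuous (cmap a \o c)}.
  move=> Ut; apply: continuous_comp; first exact: one_param_continuous.
  exact: cmap_continuous.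
elim=> [|k IH]; first by split.
split => // v; have dv t : U t -> is_derive t v (cmap a \o c) (v *: right_field a (cmap a (c t))).
  by move=> Ut; exact: is_derive_scale_direction (one_param_ode Aa Ut).
split; first by move=> t /dv[].
have CX : Ck_on k U (fun t => v *: right_field a (cmap a (c t))).
  apply/(Ck_on_row _ _ oU) => i.
  have -> : (fun t => (v *: right_field a (cmap a (c t))) 0 i) =
            (fun t => v * ((fun x => right_field a x 0 i) \o (cmap a \o c)) t).
    by apply/funext => t; rewrite mxE.
  apply: (Ck_onM oU); first exact: Ck_on_cst.
  have sx := smooth_on_coord i (@cimg_open _ _ _ a) (smooth_right_field Aa).
  have UO t : U t -> cimg a ((cmap a \o c) t) by exact: cmap_cimg.
  exact: (Ck_on_comp_curve oU (@cimg_open _ _ _ a) sx IH UO).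
by apply: (Ck_on_ext oU _ CX) => t Ut; have [_ ->] := dv t Ut.
Qed.

Section Speed.
Variable F : G -> V -> R.
Hypothesis fF : is_finsler A F.
Hypothesis invF : left_invariant A F.

Definition right_speed p := speed A F (fun r => c r * p)%g 0.

Lemma right_speed_local a p : charts A a -> cdom a p ->
  right_speed p = local_expr A F a (cmap a p) (right_field a (cmap a p)).
Proof.
move=> Aa ap; rewrite /right_speed.
have ap' : cdom a (c 0 * p)%g by rewrite one_param0 mul1g.
have cc : {for (0 : R), continuous (fun r => c r * p)%g}.
  by apply: continuous_mul; [exact: one_param_continuous|exact: cst_continuous].
by rewrite (speedE F Aa ap' cc (is_derive_flow Aa ap)) one_param0 mul1g.
Qed.

Lemma right_speed_continuous : continuous right_speed.
Proof.
move=> p; set a := chart_at A p.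
have Aa : charts A a by exact: chart_at_charts.
have ap : cdom a p by exact: chart_at_dom.
have n1 : \forall q \near p, cdom a q := near_cdom ap.
rewrite /continuous_at (right_speed_local Aa ap).
have E : {near p, (fun q => local_expr A F a (cmap a q) (right_field a (cmap a q))) =1 right_speed}.
  by apply: filterS n1 => q aq; rewrite (right_speed_local Aa aq).
apply: cvg_trans (near_eq_cvg E) _.
pose h (q : G) := (cmap a q, right_field a (cmap a q)).
have ch : {for p, continuous h}.
  apply: continuous_pair; first exact: cmap_continuous.
  apply: (@continuous_comp _ _ _ (cmap a) (right_field a)); first exact: cmap_continuous.
  exact: smooth_on_continuous (smooth_right_field Aa) (cmap_cimg ap).
have := finsler_continuous fF Aa (z := h p) (cmap_cimg ap).
exact: (continuous_comp ch).
Qed.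

(** Left translation by [c t] preserves F and commutes with left multiplication by [c r]. A maximum
    at the identity is therefore a maximum at every point of [c]. *)
Lemma right_speed_curve t p : right_speed (c t * p)%g = right_speed p.
Proof.
rewrite /right_speed -[RHS](speed_left invF (c t)).
  by congr (speed A F _ 0); apply/funext => r; rewrite !mulgA one_paramC.
apply: cderivable_mul; [exact: one_param_cderivable|exact: cderivable_cst].
Qed.

Lemma right_speed1 : right_speed 1%g = F 1%g Z.
Proof.
rewrite /right_speed /speed.
have -> : (fun r => c r * 1)%g = c by apply/funext => r; rewrite mulg1.
by rewrite ?mulg1 one_param0.
Qed.

Lemma right_speed_geodesic : Z != 0 -> (forall p, right_speed p <= right_speed 1%g) ->
  is_homogeneous_geodesic A F c.
Proof.
move=> Z0 maxc.
have speed_gt0 t : 0 < right_speed (c t).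
  by rewrite -[c t]mulg1 right_speed_curve right_speed1; exact: (finsler_gt0 fF).
split; last first.
  exists Z => //; split => //; first exact: one_param_smooth.
  exact: one_paramD.
(* A zero of the field at [c t] would give speed 0 there, whereas the speed along [c] is constant
   and positive. *)
have vel0 a t : charts A a -> cdom a (c t) -> right_field a (cmap a (c t)) != 0.
  move=> Aa act; have := speed_gt0 t; rewrite (right_speed_local Aa act).
  apply: contraTneq => ->.
  have := local_expr_homogeneous fF Aa 0 (cmap_cimg act) (lexx 0).
  by rewrite scale0r mul0r => ->; rewrite ltxx.
split; first exact: one_param_smooth.
  move=> t; have [_ E] := one_param_ode (chart_at_charts A (c t)) (chart_at_dom A (c t)).
  by rewrite /velocity derive1E E; apply: vel0; [exact: chart_at_charts|exact: chart_at_dom].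
move=> a Aa t act.
have A1 := chart_at_charts A (1%g : G).
pose L := local_expr A F a; pose m := mul_chart a1 a a; pose x := cmap a \o c.
have near_a1 : \forall s \near (0 : R), cdom a1 (c s).
  by apply: (near_continuous (@one_param_continuous 0)); exact: near_cdom.
have near_a : \forall r \near t, cdom a (c r).
  by apply: (near_continuous (@one_param_continuous t)); exact: near_cdom.
have flow s r : cdom a1 (c s) -> cdom a (c r) -> x (s + r) = m ((cmap a1 \o c) s, x r).
  by move=> as1 ar; rewrite /m /mul_chart /x /= !cmapK// one_paramD.
have dLx := finsler_smooth fF Aa.
have xt : cimg a (x t) by exact: cmap_cimg.
have dxi : differentiable (right_field a) (x t).
  exact: smooth_on_row_differentiable (fin_dim_rV R n) (@cimg_open _ _ _ a) (smooth_right_field Aa) xt.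
have homL (y v : V) (r : R) : cimg a y -> 0 <= r -> L y (r *: v) = r * L y v.
  by move=> ay r0; exact: (local_expr_homogeneous fF Aa v ay r0).
have posL (y v u : V) : cimg a y -> v != 0 -> u != 0 ->
    0 < fundamental_form (L y) v u u.
  by move=> ay v0 u0; exact: (local_expr_pos_def fF Aa ay v0 u0).
apply: (@flow_geodesic _ _ L (cimg a) (@cimg_open _ _ _ a) dLx homL posL (mul_dom a1 a a) m w0
  (@open_mul_dom a1 a a) (smooth_mul_chart A1 Aa Aa) _ x (cmap a1 \o c) t Z).
- by move=> y; exact: mul_dom_unit.
- by rewrite /= one_param0.
- exact: one_param_derive.
- apply: continuous_comp; first exact: one_param_continuous.
  exact: cmap_continuous.
- exact: xt.
- by apply: filterS near_a => r ar; apply: filterS near_a1 => s as1; exact: flow.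
- by apply: filterS near_a1 => s as1; apply: filterS near_a => r ar; exact: flow.
- exact: vel0.
(* In coordinates [f] is the square of [right_speed], which is maximal at [c t] by
   [right_speed_curve]; hence [f] is critical there. *)
- move=> v; pose f y := energy L (y, right_field a y).
  have Dom0 : [set z : V * V | cimg a z.1 /\ z.2 != 0] (x t, right_field a (x t)).
    by split; [exact: xt|exact: (vel0 a t Aa act)].
  have dQ := smooth_on_differentiable fdVV (slit_open (@cimg_open _ _ _ a))
    (smooth_energy (@cimg_open _ _ _ a) dLx) Dom0.
  have [df _] := is_derive_comp (is_derive_graph v dxi) dQ.
  pose line (h : R) := h *: v + x t.
  have line0 : line 0 = x t by rewrite /line scale0r add0r.
  have E : forall h : R, f (h *: v + x t) = (f \o line) (h *: 1 + 0).
    by move=> h; rewrite /= [h *: 1]mulr1 addr0.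
  have cline : {for (0 : R), continuous line}.
    by apply: continuousD; [exact: scalel_continuous|exact: cst_continuous].
  have fE y : cimg a y -> f y = right_speed (cinv a y) ^+ 2.
    move=> ay; rewrite (right_speed_local Aa (cinv_cdom ay)) cinvK//.
  have fmax : \forall h \near (0 : R), f (line h) <= f (line 0).
    have n0 : \forall y \near line 0, cimg a y by rewrite line0; exact: near_cimg.
    have := near_continuous cline n0.
    have E2 : f (line 0) = right_speed (c t) ^+ 2.
      by apply: etrans (congr1 f line0) _; apply: etrans (fE _ xt) _; rewrite cmapK.
    apply: filterS => h ah; move: (f (line h)) (f (line 0)) (fE _ ah) E2 => _ _ -> ->.
    rewrite ler_sqr ?nnegrE; [|exact: (finsler_ge0 fF)|exact: (finsler_ge0 fF)].
    by rewrite -[c t]mulg1 right_speed_curve.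
  have dfl : is_derive (0 : R) 1 (f \o line) ('D_v f (x t)).
    by apply: (is_derive_same_line _ E).1; exact/derivableP.
  exact: derive_local_max dfl fmax.
- have cz : {for (0 : R), continuous (fun s => ((cmap a1 \o c) s, x t))}.
    apply: continuous_pair; last exact: cst_continuous.
    by have [d _] := one_param_derive; apply/differentiable_continuous/derivable1_diffP.
  have nP : \forall z \near ((cmap a1 \o c) 0, x t), mul_dom a1 a a z.
    apply: open_nbhs_nbhs; split; first exact: open_mul_dom.
    by rewrite /= one_param0; have [] := mul_dom_unit xt.
  apply: filterS2 near_a1 (near_continuous cz nP) => s as1 Ps y.
  suff E : L (m ((cmap a1 \o c) s, x t)) ('D_(0, y) m ((cmap a1 \o c) s, x t)) = L (x t) y.
    exact: (congr1 (fun r => r ^+ 2) E).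
  (* A curve through [c t] with coordinate velocity [y]; the invariance of [L] is read off the equal
     speeds of [sg] and of its left translate by [c s]. *)
  pose sg (r : R) := cinv a (x t + r *: y).
  have sg0 : sg 0 = c t by rewrite /sg scale0r addr0 /x /= cmapK.
  have csg : {for (0 : R), continuous sg} := chart_line_continuous xt.
  have dsg : is_derive (0 : R) 1 (cmap a \o sg) y := chart_line_derive y xt.
  have asg : cdom a (sg 0) by rewrite sg0.
  have S1 := speedE F Aa asg csg dsg.
  have cdsg : cderivable A sg 0.
    by apply/(cderivableP Aa asg); split => //; case: dsg.
  have S2 := speed_left invF (c s) cdsg.
  have asg' : cdom a (c s * sg 0)%g.
    by case: Ps => _ _; rewrite /= !cmapK// sg0.
  have csg' : {for (0 : R), continuous (fun r => c s * sg r)%g}.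
    by apply: continuous_mul => //; exact: cst_continuous.
  have dsg' : is_derive (0 : R) 1 (cmap a \o (fun r => c s * sg r)%g)
      ('D_(0, y) m ((cmap a1 \o c) s, x t)).
    have := is_derive_mul A1 Aa Aa (as1 : cdom a1 ((fun=> c s) (0 : R))) asg asg'
      (@cst_continuous _ _ (c s) (0 : R)) csg (is_derive_cst_curve a1 (c s) 0) dsg.
    by rewrite sg0.
  have S3 := speedE F Aa asg' csg' dsg'.
  have E1 : m ((cmap a1 \o c) s, x t) = cmap a (c s * sg 0)%g.
    by rewrite /m /mul_chart /= !cmapK// sg0.
  have E2 : x t = cmap a (sg 0) by rewrite sg0.
  apply: etrans (congr1 (fun y' => L y' _) E1) _.
  apply: etrans (esym S3) _; apply: etrans S2 _; apply: etrans S1 _.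
  by rewrite E2.
Qed.

End Speed.
End OneParam.
End Lie.

(** * Maximisers of the speed *)

Section Conjugation.
Variables (R : realType) (n : nat) (G : topGroupType) (A : atlas R n G).
Hypothesis lieG : is_lie_group A.

Definition conj_curve (g : G) (c : R -> G) (t : R) : G := (g^-1 * c t * g)%g.

Lemma one_param_conj g c : one_param A c -> one_param A (conj_curve g c).
Proof.
move=> oc; have cd : cderivable A (conj_curve g c) 0.
  have gc := cderivable_mul lieG (cderivable_cst A g^-1%g 0) (one_param_cderivable lieG oc 0).
  have H := cderivable_mul lieG gc (cderivable_cst A g 0). exact: H.
split.
- by move=> s t; rewrite /conj_curve (one_paramD oc) !mulgA mulgK.
- move=> t; have cc := @one_param_continuous _ _ _ _ _ oc t.
  have gc := continuous_mul lieG (@cst_continuous _ _ g^-1%g t) cc.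
  have H := continuous_mul lieG gc (@cst_continuous _ _ g t); exact: H.
have [_] := cd; suff -> : conj_curve g c 0 = 1%g by [].
by rewrite /conj_curve (one_param0 oc) mulg1 mulVg.
Qed.

Variable F : G -> 'rV[R]_n -> R.
Hypothesis fF : is_finsler A F.
Hypothesis invF : left_invariant A F.

(** The conjugate flow through [p] is the left translate by [g^-1] of the original flow through
    [g * p], and left translations preserve speed. *)
Lemma right_speed_conj g c p : one_param A c ->
  right_speed A (conj_curve g c) F p = right_speed A c F (g * p)%g.
Proof.
move=> oc; have E : (fun r => conj_curve g c r * p)%g = (fun r => g^-1 * (c r * (g * p)))%g.
  by apply/funext => r; rewrite /conj_curve !mulgA.
rewrite /right_speed E (speed_left lieG invF)//.
have H := cderivable_mul lieG (one_param_cderivable lieG oc 0) (cderivable_cst A (g * p)%g 0).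
exact: H.
Qed.

(** The inequality compares the maximum with the value at the identity. It keeps the new velocity
    nonzero here, and later forces the velocities of the geodesics to grow. *)
Lemma exists_homogeneous_geodesic c : compact [set: G] -> one_param A c ->
  velocity A c 0 != 0 -> exists g, is_homogeneous_geodesic A F (conj_curve g c) /\
  F 1%g (velocity A c 0) <= F 1%g (velocity A (conj_curve g c) 0).
Proof.
move=> cG oc Z0.
have [||g _ gmax] := @compact_EVT_max G R (right_speed A c F) [set: G] _ cG.
- by exists 1%g.
- by apply: continuous_subspaceT; exact: (right_speed_continuous lieG oc fF).
have {}gmax p : right_speed A c F p <= right_speed A c F g.
  by apply: gmax; rewrite inE.
have oc' := one_param_conj g oc.
have le_speed : F 1%g (velocity A c 0) <= F 1%g (velocity A (conj_curve g c) 0).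
  by rewrite -(right_speed1 oc) -(right_speed1 oc') (right_speed_conj _ _ oc) mulg1.
exists g; split => //; apply: (right_speed_geodesic lieG oc' fF invF).
  have := lt_le_trans (finsler_gt0 fF 1%g Z0) le_speed.
  by apply: contraTneq => ->; rewrite (finsler0 fF) ltxx.
by move=> p; rewrite !(right_speed_conj _ _ oc) mulg1.
Qed.

End Conjugation.

(** * Existence of one-parameter subgroups *)

Lemma ultrafilter_fmap (T U : Type) (f : T -> U) (F : set_system T) :
  UltraFilter F -> UltraFilter (f @ F).
Proof.
move=> UF; have PF := @ultra_proper _ _ UF.
split; first exact: fmap_proper_filter.
move=> H PH FH; apply/seteqP; split => // B HB.
have [//|FnB] := in_ultra_setVsetC (f @^-1` B) UF.
have [y []] : exists y, (B `&` ~` B) y by apply: (@filter_ex _ H); apply: filterI => //; exact: FH.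
by [].
Qed.

Lemma row_norm_le (R : realType) n (v : 'rV[R]_n) (e : R) :
  0 <= e -> (forall i, `|v 0 i| <= e) -> `|v| <= e.
Proof.
move=> e0 ve; rewrite [leLHS]/Num.Def.normr/= mx_normrE (bigmax_le _ e0)//= => -[i j] _.
by rewrite ord1.
Qed.

Section Existence.
Variables (R : realType) (n : nat) (G : topGroupType) (A : atlas R n G).
Hypothesis lieG : is_lie_group A.
Local Notation V := 'rV[R]_n.
Local Notation a := (chart_at A (1%g : G)).
Local Notation w0 := (cmap a 1%g).
Local Notation m := (mul_chart a a a).
Local Notation D := (mul_dom a a a).

Let Aa : charts A a := chart_at_charts A 1%g.
Let a_1 : cdom a 1%g := chart_at_dom A 1%g.
Let aw0 : cimg a w0 := cmap_cimg a_1.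
Let cinv_w0 : cinv a w0 = 1%g := cmapK a_1.

(** At the identity the derivative of the product in its second factor is the identity map.
    Strictness gives the error bound for all base points [y] near [w0], including those reached by
    earlier factors of a product. *)
Lemma mul_chart_strict (eps : R) : 0 < eps -> exists2 d : R, 0 < d &
  forall y v : V, `|y - w0| < d -> `|v| < d ->
    D (y, w0 + v) /\ `|m (y, w0 + v) - y - v| <= eps * `|v|.
Proof.
move=> e0; have [Dw mw] := mul_dom_unit A aw0.
have oD := @open_mul_dom _ _ _ _ lieG a a a.
have sm := smooth_mul_chart lieG Aa Aa Aa.
have fd := fin_dim_prod (fin_dim_rV R n) (fin_dim_rV R n).
have Dv (v : V) : 'D_(0, v) m (w0, w0) = v.
  rewrite -derive_slice; apply: etrans (_ : 'D_v id w0 = _); last by rewrite derive_id.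
  by apply: near_eq_derive; apply: filterS (near_cimg aw0) => y /(mul_dom_unit A)[].
(* Stated for all small [d], so that finitely many coordinates share one [d]. *)
have S i : \forall d \near 0^'+, forall y v : V, `|y - w0| < d -> `|v| < d ->
    `|m (y, w0 + v) 0 i - m (y, w0) 0 i - v 0 i| <= eps * `|v|.
  have C1 := smooth_on_C1_at oD (smooth_on_coord i oD sm) Dw.
  have [_ /(_ eps e0)[d d0 Hd]] := C1_at_strictly_differentiable fd C1.
  exists d => // r /=; rewrite sub0r normrN => rd r0 y v yr vr.
  have rd' : r < d by rewrite gtr0_norm in rd.
  have E : 'D_(0, v) (fun z => m z 0 i) (w0, w0) = v 0 i.
    by rewrite -derive_row ?Dv//; exact: smooth_on_derivable sm Dw.
  have := Hd (y, w0) (0, v); rewrite E.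
  have -> : ((y, w0) : (V * V)%type) - (w0, w0) = (y - w0, 0).
    by rewrite -[LHS]/(_ - _, _ - _) subrr.
  have -> : ((y, w0) : (V * V)%type) + (0, v) = (y, w0 + v).
    by rewrite -[LHS]/(_ + _, _ + _) addr0.
  rewrite !prod_normE /= !normr0 (max_idPl _)// (max_idPr _)//.
  by apply; [exact: lt_trans rd'|exact: lt_trans rd'].
have N1 : \forall d \near 0^'+, forall y v : V, `|y - w0| < d -> `|v| < d ->
    cimg a y /\ D (y, w0 + v).
  have [d1 d10 H1] := (nbhs_ballP _ _).1 (near_cimg aw0).
  have [d2 d20 H2] := (nbhs_ballP _ _).1 (open_nbhs_nbhs (conj oD Dw)).
  near=> d => y v yd vd; split.
    apply: H1; rewrite -ball_normE /= distrC; apply: lt_trans yd _.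
    by near: d; exact: nbhs_right_lt.
  apply: H2; split => /=; rewrite -ball_normE /=.
    rewrite distrC; apply: lt_trans yd _.
    by near: d; exact: nbhs_right_lt.
  rewrite opprD addrA subrr sub0r normrN; apply: lt_trans vd _.
  by near: d; exact: nbhs_right_lt.
have [d [d0 Nd Sd]] : exists d : R, [/\ 0 < d,
    forall y v : V, `|y - w0| < d -> `|v| < d -> cimg a y /\ D (y, w0 + v) &
    forall i (y v : V), `|y - w0| < d -> `|v| < d ->
    `|m (y, w0 + v) 0 i - m (y, w0) 0 i - v 0 i| <= eps * `|v|].
  have Sall : \forall d \near 0^'+, forall i (y v : V), `|y - w0| < d -> `|v| < d ->
    `|m (y, w0 + v) 0 i - m (y, w0) 0 i - v 0 i| <= eps * `|v| by exact: filter_forall.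
  near (0 : R)^'+ => d; exists d; split.
  - by near: d; exact: nbhs_right_gt.
  - by near: d.
  - by near: d.
exists d => // y v yd vd; have [ay Dyv] := Nd y v yd vd; split => //.
apply: row_norm_le => [|i]; first by rewrite mulr_ge0// ltW.
have := Sd i y v yd vd; have -> : m (y, w0) = y.
  by rewrite /mul_chart /= cinv_w0 mulg1 cinvK.
by rewrite !mxE.
Unshelve. all: by end_near. Qed.

Section Direction.
Variable X : V.

Definition step (k : nat) : V := k.+1%:R^-1 *: X.
Definition step_elt (k : nat) : G := cinv a (w0 + step k).

(** Each factor adds an error of at most [eps] times the step. As [eps <= 1], the j-th power stays
    within twice [j |step|] of [w0], hence within [d], and the estimate applies to the next
    factor. *)
Lemma pow_estimate (eps d : R) : eps <= 1 ->
  (forall y v : V, `|y - w0| < d -> `|v| < d ->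
    D (y, w0 + v) /\ `|m (y, w0 + v) - y - v| <= eps * `|v|) ->
  forall k j, `|step k| < d -> j%:R * `|step k| < d / 2 ->
  cdom a (step_elt k ^+ j)%g /\
  `|cmap a (step_elt k ^+ j)%g - w0 - j%:R *: step k| <= eps * (j%:R * `|step k|).
Proof.
move=> e1 Hd k j kd; elim: j => [|j IH] jd.
  by rewrite expg0 scale0r subr0 subrr normr0 mul0r mulr0.
have jd' : j%:R * `|step k| < d / 2.
  by apply: le_lt_trans jd; rewrite ler_wpM2r// ler_nat.
have [cj ej] := IH jd'; set y := cmap a (step_elt k ^+ j)%g in ej.
have yd : `|y - w0| < d.
  rewrite -(subrK (j%:R *: step k) (y - w0)) (le_lt_trans (ler_normD _ _))//.
  rewrite [ltRHS]splitr ler_ltD//; last by rewrite normrZ normr_nat.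
  by rewrite (le_trans ej)// (le_trans _ (ltW jd'))// ler_piMl// mulr_ge0.
have [[_ ax cp] es] := Hd y (step k) yd kd.
have cinvy : cinv a y = (step_elt k ^+ j)%g by rewrite cmapK.
have E : m (y, w0 + step k) = cmap a (step_elt k ^+ j.+1)%g.
  by rewrite /mul_chart /= cinvy expgSr.
split; first by move: cp; rewrite /= cinvy expgSr.
rewrite -E -[j.+1]addn1 natrD !mulrDl mul1r scalerDl scale1r mulrDr.
have -> : m (y, w0 + step k) - w0 - (j%:R *: step k + step k) =
    (y - w0 - j%:R *: step k) + (m (y, w0 + step k) - y - step k).
  by move: (m _) (j%:R *: _) => p q; apply/rowP => i; rewrite !mxE; ring.
by rewrite (le_trans (ler_normD _ _))// lerD.
Qed.

End Direction.
End Existence.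

(** * Limits of powers along an ultrafilter *)

Section Limit.
Variables (R : realType) (n : nat) (G : topGroupType) (A : atlas R n G).
Hypothesis lieG : is_lie_group A.
Local Notation V := 'rV[R]_n.
Local Notation a := (chart_at A (1%g : G)).
Local Notation w0 := (cmap a 1%g).
Local Notation m := (mul_chart a a a).
Local Notation D := (mul_dom a a a).
Let a_1 : cdom a 1%g := chart_at_dom A 1%g.
Let aw0 : cimg a w0 := cmap_cimg a_1.
Let cinv_w0 : cinv a w0 = 1%g := cmapK a_1.

Lemma cvg_mulg (T : Type) (F : set_system T) (FF : Filter F) (f g : T -> G) (x y : G) :
  f @ F --> x -> g @ F --> y -> (fun t => f t * g t)%g @ F --> (x * y)%g.
Proof.
move=> fx gy.
have H := @cvg_comp _ _ _ (fun t => (f t, g t)) (fun z : G * G => (z.1 * z.2)%g) F _ _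
  (cvg_pair fx gy) (@lie_mul_continuous _ _ _ _ lieG (x, y)).
exact: H.
Qed.

Variables (X : V) (U : set_system nat).
Hypothesis compactG : compact [set: G].
Hypothesis UU : UltraFilter U.
Hypothesis ooU : \oo `<=` U.
Local Notation h := (step_elt A X).
Let PU : ProperFilter U := @ultra_proper _ _ UU.

Lemma step_cvg : step X @ U --> (0 : V).
Proof.
have : step X @ \oo --> (0 : V).
  rewrite -(scale0r X); apply: cvgZr_tmp; exact: cvg_harmonic.
by apply: cvg_trans => B; exact: ooU.
Qed.

Lemma step_elt_cvg : h @ U --> 1%g.
Proof.
have c1 : {for (0 : V), continuous (fun v => cinv a (w0 + v))}.
  apply: (@continuous_comp _ _ _ (fun v => w0 + v) (cinv a)).
    by apply: continuousD; [exact: cst_continuous|exact: cvg_id].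
  by rewrite addr0; exact: cinv_continuous.
have := @cvg_comp _ _ _ (step X) (fun v => cinv a (w0 + v)) U _ _ step_cvg c1.
by rewrite addr0 cinv_w0.
Qed.

(** Only natural powers occur, so the lemmas on the limit ask for [0 <= t]; negative times are
    supplied by [extend_hom]. *)
Definition pow_seq (t : R) (k : nat) : G := (h k ^+ Num.truncn (k.+1%:R * t))%g.

Lemma pow_seq_cvg t : exists g : G, pow_seq t @ U --> g.
Proof.
have := compactG; rewrite compact_ultra => /(_ _ (ultrafilter_fmap (pow_seq t) UU)).
have US : (pow_seq t @ U) [set: G] by exact: filterT.
by move=> /(_ US)[g [_ gU]]; exists g.
Qed.

(* The ultrafilter makes the limit exist for every t at once. *)
Definition pow_lim t : G := projT1 (cid (pow_seq_cvg t)).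

Lemma pow_limP t : pow_seq t @ U --> pow_lim t.
Proof. by rewrite /pow_lim; case: cid. Qed.

(** Truncation is additive up to 0 or 1, so the two sides differ by at most one factor [h k], which
    tends to the identity. *)
Lemma pow_limD (s t : R) : 0 <= s -> 0 <= t -> pow_lim (s + t) = (pow_lim s * pow_lim t)%g.
Proof.
move=> s0 t0; pose N r k := Num.truncn (k.+1%:R * r : R).
pose e k := (h k ^+ (N (s + t)%R k - (N s k + N t k))%N)%g.
have E k : pow_seq (s + t) k = (pow_seq s k * pow_seq t k * e k)%g /\
    (N (s + t)%R k - (N s k + N t k) <= 1)%N.
  have k0 : 0 <= k.+1%:R :> R by [].
  have /andP[s1 s2] := truncn_itv (mulr_ge0 k0 s0).
  have /andP[t1 t2] := truncn_itv (mulr_ge0 k0 t0).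
  have st0 := mulr_ge0 k0 (addr_ge0 s0 t0).
  have le1 : (N s k + N t k <= N (s + t)%R k)%N.
    by rewrite /N truncn_ge_nat// natrD mulrDr lerD.
  split; last first.
    rewrite leq_subLR addn1 -ltnS truncn_lt_nat// mulrDr.
    have -> : (N s k + N t k).+2 = ((N s k).+1 + (N t k).+1)%N by rewrite addSn addnS.
    by rewrite natrD ltrD.
  by rewrite /pow_seq /e -!expgnDr -/(N _ _) subnKC.
have ecvg : e @ U --> 1%g.
  move=> B B1; have hB : U [set k | B (h k)] := step_elt_cvg B1.
  suff : U [set k | B (e k)] by [].
  apply: filterS hB => k hk; rewrite /= /e.
  case: (E k) => _; case: (_ - _)%N => [|[|//]] _.
    by rewrite expg0; exact: nbhs_singleton.
  by rewrite expg1.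
have := cvg_mulg PU (cvg_mulg PU (@pow_limP s) (@pow_limP t)) ecvg.
have -> : (fun k => pow_seq s k * pow_seq t k * e k)%g = pow_seq (s + t).
  by apply/funext => k; rewrite (E k).1.
rewrite mulg1 => c1.
exact: (cvg_unique (lie_hausdorff lieG) (@pow_limP (s + t)) c1).
Qed.

Lemma pow_lim_estimate (eps : R) : 0 < eps -> eps <= 1 -> exists2 eta : R, 0 < eta &
  forall t : R, 0 <= t -> t < eta -> cdom a (pow_lim t) /\
    `|cmap a (pow_lim t) - w0 - t *: X| <= eps * (t * `|X|).
Proof.
have PU' : ProperFilter U := @ultra_proper _ _ UU.
have FU : Filter U := @filter_filter _ _ PU'.
move=> e0 e1; have [d d0 Hd] := mul_chart_strict lieG e0.
have X1 : 0 < 1 + `|X| by rewrite ltr_pwDl.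
have k0 : 0 < 4 * (1 + `|X|) by rewrite mulr_gt0.
(* This makes [t |X| < d / 4]: the hypothesis of [pow_estimate] holds, and as [eps <= 1] the powers
   stay within [2 t |X| < d / 2] of [w0] in the chart. *)
exists (d / (4 * (1 + `|X|))); first by rewrite divr_gt0.
move=> t t0; rewrite ltr_pdivlMr// => td.
have tX : t * `|X| < d / 4.
  rewrite ltr_pdivlMr// -mulrA (le_lt_trans _ td)// ler_wpM2l//.
  by rewrite mulrC ler_wpM2l// lerDr.
have near_step (r : R) : 0 < r -> U [set k | `|step X k| < r].
  move=> r0; have H : U [set k | `|0 - step X k| < r] by exact: ((cvgrPdist_lt _ _).1 step_cvg).
  by apply: filterS H => k; rewrite /= sub0r normrN.
pose j k := Num.truncn (k.+1%:R * t).
have jle k : (j k)%:R <= k.+1%:R * t /\ k.+1%:R * t < (j k)%:R + 1.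
  have /andP[p1 p2] := truncn_itv (mulr_ge0 (ler0n R k.+1) t0).
  by rewrite natr1.
have tXE k : t *: X = (k.+1%:R * t) *: step X k.
  by rewrite /step scalerA mulrAC mulfV ?mul1r// pnatr_eq0.
have jk k : (j k)%:R * `|step X k| <= t * `|X|.
  have -> : t * `|X| = k.+1%:R * t * `|step X k|.
    by rewrite -{1}(ger0_norm t0) -normrZ (tXE k) normrZ [`|_ * t|]ger0_norm ?mulr_ge0.
  by rewrite ler_wpM2r// (jle k).1.
have est k : `|step X k| < d -> cdom a (pow_seq t k) /\
    `|cmap a (pow_seq t k) - w0 - (j k)%:R *: step X k| <= eps * (t * `|X|).
  move=> kd.
  have [|c1 c2] := pow_estimate e1 Hd (k := k) (j := j k) kd.
    rewrite (le_lt_trans (jk k))// (lt_trans tX)// ltr_pM2l// ltf_pV2 ?posrE//.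
    by rewrite ltr_nat.
  by split => //; rewrite (le_trans c2)// ler_wpM2l// ltW.
have jdiff k : `|(j k)%:R *: step X k - t *: X| <= `|step X k|.
  rewrite (tXE k) -scalerBl normrZ ler_piMl// ler_norml; have [] := jle k; lra.
(* A limit in G could leave the chart. The compact ball [B] has a compact, hence closed, image in G,
   and this image retains the limit. *)
pose B := closed_ball w0 (d / 2).
have d2 : 0 < d / 2 by rewrite divr_gt0.
have BE : B = [set y | `|w0 - y| <= d / 2] by rewrite /B closed_ballE.
have aB y : B y -> cimg a y.
  rewrite BE /= distrC => yd.
  have yd' : `|y - w0| < d by rewrite (le_lt_trans yd)// ltr_pdivrMr// mulr_natr mulr2n ltrDl.
  by have [|[ay _ _] _] := Hd y 0 yd'; rewrite ?normr0.
have cB : compact B.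
  apply: bounded_closed_compact; last exact: closed_ball_closed.
  exists (`|w0| + d / 2); split; first exact: num_real.
  move=> M wM y; rewrite BE /= => yd; rewrite (le_trans _ (ltW wM))//.
  by rewrite -[y](subKr w0) (le_trans (ler_normB _ _))// lerD2l.
have ccB : compact (cinv a @` B).
  apply: continuous_compact => //; apply: continuous_in_subspaceT => y /set_mem /aB.
  exact: cinv_continuous.
have UB : U [set k | (cinv a @` B) (pow_seq t k)].
  apply: (@filterS _ U FU _ _ _ (near_step d d0)) => k kd; have [c1 c2] := est k kd.
  exists (cmap a (pow_seq t k)); last by rewrite cmapK.
  rewrite BE /= distrC -(subrK ((j k)%:R *: step X k) (_ - w0)).
  have c3 : `|(j k)%:R *: step X k| <= t * `|X| by rewrite normrZ normr_nat; exact: jk.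
  rewrite (le_trans (ler_normD _ _))// (le_trans (lerD c2 c3))//.
  have : eps * (t * `|X|) <= t * `|X| by rewrite ler_piMl// mulr_ge0.
  by move: tX; lra.
have [y By yE] := closed_cvg _ (compact_closed (lie_hausdorff lieG) ccB) UB _ (@pow_limP t).
have ap : cdom a (pow_lim t) by rewrite -yE; exact/cinv_cdom/aB.
(* Two further errors tend to 0: the distance to the limit in the chart, and the truncation of
   [k.+1%:R * t] to [j k], worth at most one step. *)
split => //; apply/ler_addgt0Pr => e' e'0.
have e'2 : 0 < e' / 2 by rewrite divr_gt0.
have cc : (cmap a \o pow_seq t) @ U --> cmap a (pow_lim t).
  have H := (@cvg_comp _ _ _ (pow_seq t) (cmap a) U _ _ (@pow_limP t) (cmap_continuous ap)); exact: H.
have [k [k1 k2 k3]] : exists k, [/\ `|cmap a (pow_lim t) - cmap a (pow_seq t k)| < e' / 2,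
    `|step X k| < e' / 2 & `|step X k| < d].
  have H : U [set k | `|cmap a (pow_lim t) - cmap a (pow_seq t k)| < e' / 2].
    by exact: ((cvgrPdist_lt _ _).1 cc).
  apply: (@filter_ex _ U); apply: (@filterS3 _ U FU _ _ _ _ _ H (near_step _ e'2) (near_step _ d0)).
  by move=> k; split.
have [_ c2] := est k k3.
have -> : cmap a (pow_lim t) - w0 - t *: X =
  (cmap a (pow_lim t) - cmap a (pow_seq t k)) +
  ((cmap a (pow_seq t k) - w0 - (j k)%:R *: step X k) + ((j k)%:R *: step X k - t *: X)).
  move: (cmap a (pow_lim t)) (cmap a (pow_seq t k)) ((j k)%:R *: step X k) => p q r.
  by apply/rowP => i; rewrite !mxE; ring.
rewrite (le_trans (ler_normD _ _))//.
have := ler_normD (cmap a (pow_seq t k) - w0 - (j k)%:R *: step X k) ((j k)%:R *: step X k - t *: X).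
have := jdiff k; lra.
Qed.

End Limit.

(** * Extension to negative times *)

Section Extension.
Variables (R : realType) (n : nat) (G : topGroupType) (A : atlas R n G).
Hypothesis lieG : is_lie_group A.
Local Notation V := 'rV[R]_n.
Local Notation a := (chart_at A (1%g : G)).
Local Notation w0 := (cmap a 1%g).
Let a_1 : cdom a 1%g := chart_at_dom A 1%g.
Let aw0 : cimg a w0 := cmap_cimg a_1.
Let cinv_w0 : cinv a w0 = 1%g := cmapK a_1.

Variables (p : R -> G) (X : V).
Hypothesis pD : forall s t : R, 0 <= s -> 0 <= t -> p (s + t) = (p s * p t)%g.
Hypothesis p_estimate : forall eps : R, 0 < eps -> eps <= 1 -> exists2 eta : R, 0 < eta &
  forall t : R, 0 <= t -> t < eta -> cdom a (p t) /\
    `|cmap a (p t) - w0 - t *: X| <= eps * (t * `|X|).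

(* Any base point N >= max 0 (-t) in place of `|t| gives the same value, which
   makes additivity a telescoping product. *)
Definition extend_hom (t : R) : G := ((p `|t|)^-1 * p (`|t| + t))%g.
Local Notation c := extend_hom.

Let p0 : p 0 = 1%g.
Proof. by apply: (mulgI (p 0)); rewrite -pD// addr0 mulg1. Qed.

Lemma extend_homE (N t : R) : 0 <= N -> 0 <= N + t -> c t = ((p N)^-1 * p (N + t))%g.
Proof.
have shift (K M : R) : 0 <= K -> 0 <= K + t -> K <= M ->
    ((p M)^-1 * p (M + t) = (p K)^-1 * p (K + t))%g.
  move=> K0 Kt KM.
  have -> : p (M + t) = (p (M - K) * p (K + t))%g by rewrite -pD ?subr_ge0// addrA subrK.
  have -> : p M = (p (M - K) * p K)%g by rewrite -pD ?subr_ge0// subrK.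
  by rewrite invgM -!mulgA mulKg.
move=> N0 Nt; have t0 : 0 <= `|t| by [].
have tt : 0 <= `|t| + t by have := ler_norm (- t); rewrite normrN; lra.
have [le_tN|/ltW le_Nt] := leP `|t| N; first by rewrite /extend_hom (shift `|t| N).
by rewrite /extend_hom (shift N `|t|).
Qed.

Lemma extend_hom_pos (t : R) : 0 <= t -> c t = p t.
Proof. by move=> t0; rewrite (@extend_homE 0)// add0r// p0 invg1 mul1g. Qed.

Lemma extend_homD (s t : R) : c (s + t) = (c s * c t)%g.
Proof.
have := ler_norm (- s); have := ler_norm (- t); have := ler_norm s; have := ler_norm t.
rewrite !normrN => t1 s1 t2 s2.
rewrite (@extend_homE (`|s| + `|t|) s); [|lra|lra].
rewrite (@extend_homE (`|s| + `|t| + s) t); [|lra|lra].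
rewrite (@extend_homE (`|s| + `|t|) (s + t)); [|lra|lra].
by rewrite addrA -mulgA mulVKg.
Qed.

Let c0 : c 0 = 1%g. Proof. by rewrite extend_hom_pos. Qed.

Lemma extend_homN t : c (- t) = (c t)^-1%g.
Proof. by apply/esym/mulg1_eq; rewrite -extend_homD subrr. Qed.

Let X1 : 0 < 1 + `|X|. Proof. by rewrite ltr_pwDl. Qed.

Let continuous0 : {for (0 : R), continuous c}.
Proof.
move=> B; rewrite c0 => B1.
(* A neighbourhood stable enough for inverses handles negative times, where [c t] is the inverse of
   [p (- t)]. *)
have W1 : \forall g \near (1%g : G), B g /\ B (g^-1)%g.
  apply: filterI => //.
  have := lie_inv_continuous lieG (x := 1%g); rewrite /continuous_at invg1; exact.
have cc : \forall y \near w0, B (cinv a y) /\ B (cinv a y)^-1%g.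
  rewrite -cinv_w0 in W1; exact: (near_continuous (cinv_continuous aw0) W1).
have [r /= r0 Hr] := (nbhs_ballP _ _).1 cc.
have [eta eta0 He] := p_estimate ltr01 (lexx 1).
have k0 : 0 < r / (2 * (1 + `|X|)) by rewrite divr_gt0// mulr_gt0.
suff : \forall t \near (0 : R), B (c t) by [].
have : \forall t \near (0 : R), `|t| < Num.min eta (r / (2 * (1 + `|X|))).
  exists (Num.min eta (r / (2 * (1 + `|X|)))) => /=; first by rewrite lt_min eta0.
  by move=> t /=; rewrite sub0r normrN.
apply: filterS => t; rewrite lt_min => /andP[te tr].
have [ap ep] := He _ (normr_ge0 t) te.
have [] : B (p `|t|) /\ B (p `|t|)^-1%g.
  have := Hr (cmap a (p `|t|)); rewrite /= cmapK//; apply.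
  rewrite -ball_normE /= distrC -(subrK (`|t| *: X) (_ - w0)).
  rewrite (le_lt_trans (ler_normD _ _))// (le_lt_trans (lerD ep (lexx _)))//.
  rewrite normrZ normr_id mul1r.
  move: tr; rewrite ltr_pdivlMr ?mulr_gt0//; have := normr_ge0 t.
  by set T := `|t|; set Y := `|X|; lra.
have [t0|t0] := leP 0 t.
  by rewrite ger0_norm// extend_hom_pos.
rewrite ltr0_norm// => _; rewrite -extend_hom_pos ?oppr_ge0 ?ltW//.
by rewrite extend_homN invgK.
Qed.

Let continuousc (t : R) : {for t, continuous c}.
Proof.
have -> : c = (fun s => c (s - t) * c t)%g.
  by apply/funext => s; rewrite -extend_homD subrK.
apply: (continuous_mul lieG); last exact: cst_continuous.
apply: (@continuous_comp _ _ _ (fun s => s - t) c).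
  by apply: continuousD; [exact: cvg_id|exact: cst_continuous].
by rewrite subrr.
Qed.

(** For negative [t] the multiplication estimate is applied to c(-t) c(t) = 1. With [v] the
    displacement of [c t], the term [eps |v|] is absorbed since [eps <= 1/2], giving
    [|v| <= 4 |t| |X|]; the error is then at most 4 + 1 times [eps |t| |X|]. *)
Let estimate (eps : R) : 0 < eps -> eps <= 2^-1 ->
  \forall t \near (0 : R), `|cmap a (c t) - w0 - t *: X| <= 5 * eps * (`|t| * `|X|).
Proof.
move=> e0 e2; have e1 : eps <= 1 by lra.
have [eta eta0 He] := p_estimate e0 e1.
have [d d0 Hd] := mul_chart_strict lieG e0.
have near_a : \forall t \near (0 : R), cdom a (c t).
  by apply: (near_continuous continuous0); rewrite c0; exact: near_cdom.
have near_d : \forall t \near (0 : R), `|cmap a (c t) - w0| < d.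
  have cac : {for (0 : R), continuous (cmap a \o c)}.
    apply: continuous_comp; first exact: continuous0.
    by rewrite c0; exact: cmap_continuous.
  have : \forall y \near (cmap a \o c) 0, `|y - w0| < d.
    rewrite /= c0; apply/nbhs_ballP; exists d => // y.
    by rewrite -ball_normE /= distrC.
  exact: (near_continuous cac).
have near_dN : \forall t \near (0 : R), `|cmap a (c (- t)) - w0| < d.
  have : \forall t \near - (0 : R), `|cmap a (c t) - w0| < d by rewrite oppr0.
  apply: (near_continuous (f := -%R)); exact: opp_continuous.
have near_e : \forall t \near (0 : R), `|t| < eta.
  by exists eta => // t /=; rewrite sub0r normrN.
have X0 := normr_ge0 X.
near=> t.
have te : `|t| < eta by near: t.
have [t0|t0] := leP 0 t.
  rewrite ger0_norm// in te *; rewrite extend_hom_pos//.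
  have [_ est] := He _ t0 te; rewrite (le_trans est)// ler_wpM2r ?mulr_ge0//; lra.
have s0 : 0 <= - t by rewrite oppr_ge0 ltW.
rewrite ltr0_norm// in te *.
have [as_ est] := He _ s0 te.
have ac : cdom a (c t) by near: t.
have zd : `|cmap a (p (- t)) - w0| < d by rewrite -extend_hom_pos//; near: t.
have vd : `|cmap a (c t) - w0| < d by near: t.
have [_] := Hd _ _ zd vd.
have -> : mul_chart a a a (cmap a (p (- t)), w0 + (cmap a (c t) - w0)) = w0.
  rewrite addrC subrK /mul_chart /= !cmapK// -extend_hom_pos//.
  by rewrite -extend_homD addNr c0.
move: est zd vd; move: (cmap a (p (- t))) (cmap a (c t)) => z z' est _ _.
set v := z' - w0 => ev.
have h1 : `|v| <= `|w0 - z - v| + `|z - w0|.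
  have := ler_normB (w0 - z) (w0 - z - v).
  by rewrite subKr addrC [`|w0 - z|]distrC.
have h2 : `|z - w0| <= `|z - w0 - (- t) *: X| + - t * `|X|.
  have := ler_normD (z - w0 - (- t) *: X) ((- t) *: X).
  by rewrite subrK normrZ [`|- t|]ger0_norm.
have h3 : `|v - t *: X| <= `|w0 - z - v| + `|z - w0 - (- t) *: X|.
  have -> : v - t *: X = - (w0 - z - v) - (z - w0 - (- t) *: X).
    by apply/rowP => i; rewrite !mxE; ring.
  by rewrite (le_trans (ler_normB _ _))// normrN.
have h4 : - t * `|X| >= 0 by rewrite mulr_ge0.
have h5 : `|v| <= 4 * (- t * `|X|).
  have hv : eps * `|v| <= 2^-1 * `|v| by rewrite ler_wpM2r.
  have hs : eps * (- t * `|X|) <= 2^-1 * (- t * `|X|) by rewrite ler_wpM2r.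
  lra.
have h6 : eps * `|v| <= eps * (4 * (- t * `|X|)) by rewrite ler_wpM2l// ltW.
lra.
Unshelve. all: by end_near. Qed.

Let derive0 : is_derive (0 : R) 1 (cmap a \o c) X.
Proof.
have cv : h^-1 *: (((cmap a \o c) \o shift 0) (h *: 1) - (cmap a \o c) 0) @[h --> (0 : R)^'] --> X.
  apply/cvgrPdist_le => e e0.
  pose eps := Num.min 2^-1 (e / (5 * (1 + `|X|))).
  have eps0 : 0 < eps by rewrite lt_min invr_gt0 ltr0n divr_gt0// mulr_gt0.
  have eps2 : eps <= 2^-1 by rewrite ge_min lexx.
  have epse : eps * (5 * (1 + `|X|)) <= e.
    by rewrite -ler_pdivlMr ?mulr_gt0// ge_min lexx orbT.
  have est := estimate eps0 eps2.
  have n0 : \forall h \near (0 : R)^', h != 0 by exact: nbhs_dnbhs_neq.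
  apply: filterS2 n0 (nbhs_dnbhs est) => h h0.
  rewrite /= [h *: 1]mulr1 addr0 c0 => eh.
  have -> : X - h^-1 *: (cmap a (c h) - w0) = - (h^-1 *: (cmap a (c h) - w0 - h *: X)).
    by rewrite [in RHS]scalerBr scalerA mulVf// scale1r opprB.
  rewrite normrN normrZ normfV ler_pdivrMl ?normr_gt0//.
  rewrite (le_trans eh)// -[5 * eps]mulrC mulrCA ler_wpM2l//.
  apply: le_trans epse; rewrite -mulrA ler_wpM2l ?(ltW eps0)// ler_wpM2l//.
  by rewrite lerDr.
split; first by apply/cvg_ex; exists X.
exact: cvg_lim cv.
Qed.

Lemma extend_hom_one_param : one_param A c /\ velocity A c 0 = X.
Proof.
have oc : one_param A c.
  split; [exact: extend_homD|exact: continuousc|by case: derive0].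
split => //; rewrite /velocity c0 derive1E; by case: derive0.
Qed.

End Extension.

Lemma exists_one_param (R : realType) (n : nat) (G : topGroupType) (A : atlas R n G)
    (X : 'rV[R]_n) : is_lie_group A -> compact [set: G] ->
  exists2 c, one_param A c & velocity A c 0 = X.
Proof.
move=> lieG cG; have [U [UU ooU]] := ultraFilterLemma eventually_filter.
have [] := extend_hom_one_param lieG (pow_limD lieG X cG UU ooU)
  (pow_lim_estimate lieG X cG UU ooU).
by exists (extend_hom (pow_lim A X cG UU)).
Qed.

(** * Geodesics with the same range *)

(** Both derivatives exist, so times accumulating at 0 determine them; in use the two curves are
    known to agree at dyadic times only. *)
Lemma is_derive_unique_frequently (R : realType) (V : normedModType R) (f g : R -> V) df dg :
  is_derive (0 : R) 1 f df -> is_derive (0 : R) 1 g dg -> f 0 = g 0 ->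
  (forall d : R, 0 < d -> exists t : R, [/\ t != 0, `|t| < d & f t = g t]) -> df = dg.
Proof.
move=> [fc <-] [gc <-] fg0 fg; apply/eqP; rewrite -subr_eq0 -normr_le0.
apply/ler_addgt0Pr => e e0; rewrite add0r.
have cvq (k : R -> V) : derivable k 0 1 ->
    h^-1 *: (k h - k 0) @[h --> (0 : R)^'] --> 'D_1 k 0.
  have -> : (fun h : R => h^-1 *: (k h - k 0)) =
            (fun h => h^-1 *: ((k \o shift 0) (h *: 1) - k 0)).
    by apply/funext => h /=; rewrite [h *: 1]mulr1 addr0.
  exact.
have e2 : 0 < e / 2 by rewrite divr_gt0.
have n1 : \forall h \near (0 : R)^', `|'D_1 f 0 - h^-1 *: (f h - f 0)| <= e / 2.
  exact: ((cvgrPdist_le _ _).1 (cvq f fc)).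
have n2 : \forall h \near (0 : R)^', `|'D_1 g 0 - h^-1 *: (g h - g 0)| <= e / 2.
  exact: ((cvgrPdist_le _ _).1 (cvq g gc)).
have [d /= d0 Hd] := filterI n1 n2.
have [t [t0 td ft]] := fg d d0.
have [] := Hd t; rewrite /= ?sub0r ?normrN//.
rewrite ft fg0; move: (t^-1 *: _) => q h1 h2.
rewrite -(subrKA q) (le_trans (ler_normD _ _))// [leRHS]splitr lerD//.
by rewrite distrC.
Qed.

Section Ranges.
Variables (R : realType) (n : nat) (G : topGroupType) (A : atlas R n G).
Hypothesis lieG : is_lie_group A.
Local Notation V := 'rV[R]_n.
Local Notation a := (chart_at A (1%g : G)).
Local Notation w0 := (cmap a 1%g).
Let Aa : charts A a := chart_at_charts A 1%g.
Let a_1 : cdom a 1%g := chart_at_dom A 1%g.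

(** With zero velocity the right-invariant field vanishes, so the coordinates have zero derivative
    as long as the curve stays in the chart. *)
Lemma one_param_velocity0 c : one_param A c -> velocity A c 0 = 0 ->
  \forall t \near (0 : R), c t = 1%g.
Proof.
move=> oc Z0.
have near_a : \forall t \near (0 : R), cdom a (c t).
  have nc : \forall g \near c 0, cdom a g by rewrite (one_param0 oc); exact: near_cdom.
  exact: (near_continuous (@one_param_continuous _ _ _ _ _ oc 0) nc).
have ode (t : R) : cdom a (c t) -> is_derive t 1 (cmap a \o c) 0.
  move=> ac; have := one_param_ode lieG oc Aa ac.
  have E0 : ((0, 0) : (V * V)%type) = 0 by [].
  by rewrite /right_field Z0 E0 derive0.
have [d /= d0 Hd] := near_a.
exists d => // t /=; rewrite sub0r normrN => td.
have cs (s : R) : `|s| <= `|t| -> cdom a (c s).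
  by move=> st; apply: Hd; rewrite /= sub0r normrN (le_lt_trans st).
have xt : cmap a (c t) = w0.
  apply/rowP => i.
  have dv (s : R) : `|s| <= `|t| -> is_derive (0 + s *: (1 : R)) 1 (fun r => (cmap a \o c) r 0 i) 0.
    move=> st; rewrite add0r [s *: 1]mulr1; have := is_derive_row i (ode s (cs s st)).
    by rewrite mxE.
  have [s st] := @MVT_line _ _ (fun r => (cmap a \o c) r 0 i) 0 1 t
    (fun s st => @ex_derive _ _ _ _ _ _ _ (dv s st)).
  rewrite (@derive_val _ _ _ _ _ _ _ (dv s st)) mul0r add0r [t *: 1]mulr1 /=.
  by rewrite (one_param0 oc) => /eqP; rewrite subr_eq0 => /eqP.
by rewrite -(cmapK (cs t (lexx _))) xt cmapK.
Qed.

Lemma int_norm_lt1 (r : R) : r \is a Num.int -> `|r| < 1 -> r = 0.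
Proof.
move=> /intrP[k ->]; rewrite -intr_norm ltrz1 => k1.
by apply/eqP; rewrite intr_eq0; move: k1; rewrite -[X in _ < X](add0r 1) ltzD1 normr_le0.
Qed.

(** Small times of [c'] correspond to small times of [c]. Along a halving sequence of times this
    correspondence is exactly linear, and its slope [q] is the ratio of the velocities. *)
Lemma periodic_range_velocity c c' : one_param A c -> one_param A c' ->
  (forall t, c t = 1%g <-> t \is a Num.int) ->
  (forall t, c' t = 1%g <-> t \is a Num.int) ->
  range c = range c' ->
  exists2 q : R, q \is a Num.int & velocity A c' 0 = q *: velocity A c 0.
Proof.
move=> oc oc' kc kc' rcc.
(* Modulo integers every time of [c] has a representative in [-1/2, 1/2]; it lies in [K] unless it
   is smaller than 1/4. The compact image of [K] misses the identity, so small times of [c'] avoid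
   it. The bound 1/4 makes [2 s_(k+1) - s_k] smaller than 1. *)
pose K : set R := [set s | 4^-1 <= `|s| <= 2^-1].
have cK : compact K.
  have -> : K = `[(- 2^-1 : R), 2^-1] `&` [set s | 4^-1 <= `|s|].
    apply/seteqP; split=> s; rewrite /K /= in_itv /= -ler_norml.
      by move=> /andP[-> ->].
    by move=> [-> ->].
  apply: compact_closedI; first exact: segment_compact.
  apply: (@closed_comp _ _ (fun s : R => `|s|) [set x | 4^-1 <= x]) => [s _|].
    exact: norm_continuous.
  exact: closed_ge.
have ccK : closed (c @` K).
  apply: (compact_closed (lie_hausdorff lieG)); apply: continuous_compact => //.
  by apply: continuous_subspaceT => s; exact: (one_param_continuous oc).
have nK : ~ (c @` K) 1%g.
  move=> [s /andP[s1 s2] /kc /int_norm_lt1 s0]; move: s1.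
  by rewrite s0 ?normr0 ?leNgt ?invr_gt0 ?ltr0n//; lra.
have near_c' : \forall t \near (0 : R), ~ (c @` K) (c' t).
  have nc : \forall g \near c' 0, ~ (c @` K) g.
    rewrite (one_param0 oc'); apply: open_nbhs_nbhs; split => //.
    exact: closed_openC.
  exact: (near_continuous (@one_param_continuous _ _ _ _ _ oc' 0) nc).
have [d /= d0 Hd] := near_c'.
have small t : `|t| < d -> exists2 s, `|s| < 4^-1 & c s = c' t.
  move=> td; have : range c (c' t) by rewrite rcc; exists t.
  move=> [s0 _ cs0]; pose k := Num.floor (s0 + 2^-1).
  have /andP[k1 k2] := floor_itv (s0 + 2^-1).
  have ck : c (s0 - k%:~R) = c' t.
    rewrite (one_paramD oc) cs0 (_ : c (- k%:~R) = 1%g) ?mulg1//.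
    by apply/kc; rewrite rpredN intr_int.
  have s2 : `|s0 - k%:~R| <= 2^-1.
    move: k1 k2; rewrite -/k intrD => k1 k2; rewrite ler_norml; lra.
  exists (s0 - k%:~R) => //; rewrite ltNge; apply/negP => s4.
  have := Hd t; rewrite /= sub0r normrN => /(_ td); apply.
  by exists (s0 - k%:~R) => //; rewrite /K /= s4.
have [m md] : exists m, 2^-1 ^+ m < d.
  have := @cvg_expr R 2^-1; rewrite ger0_norm ?invr_ge0// invf_lt1 ?ltr1n// => /(_ isT).
  move=> /cvgrPdist_lt /(_ d d0)[m _ Hm]; exists m.
  by have := Hm m (leqnn m); rewrite /= sub0r normrN ger0_norm ?exprn_ge0 ?invr_ge0.
(* Dyadic times below [d], each matched by a small time [s k] of [c]; integer multiples of them
   reach the period 1. *)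
pose t k : R := 2^-1 ^+ (m + k).
have t0 k : 0 < t k by rewrite exprn_gt0// invr_gt0.
have td k : `|t k| < d.
  rewrite gtr0_norm//; apply: le_lt_trans md.
  by rewrite /t exprD ler_piMr ?exprn_ge0 ?invr_ge0// exprn_ile1 ?invr_ge0// invf_le1 ?ler1n.
have /choice[s sP] : forall k, exists s, `|s| < 4^-1 /\ c s = c' (t k).
  by move=> k; have [s s1 s2] := small _ (td k); exists s.
(* 2 s_(k+1) - s_k lies in the kernel of c and is less than 1 in absolute value. *)
have sS k : s k = 2 * s k.+1.
  have tS : t k = t k.+1 + t k.+1.
    by rewrite /t addnS exprS; move: (_ ^+ (m + k)) => z; lra.
  apply/eqP; rewrite eq_sym -subr_eq0; apply/eqP/int_norm_lt1.
    apply/kc; rewrite mulr2n mulrDl mul1r !(one_paramD oc).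
    have -> : c (- s k) = (c (s k))^-1%g.
      by apply/esym/mulg1_eq; rewrite -(one_paramD oc) subrr (one_param0 oc).
    by rewrite (sP k).2 (sP k.+1).2 -(one_paramD oc') -tS mulgV.
  have [s1 _] := sP k; have [s2 _] := sP k.+1.
  by move: s1 s2; rewrite !ltr_norml => /andP[? ?] /andP[? ?]; lra.
have sE k : s k = s 0%N / 2 ^+ k.
  elim: k => [|k IH]; first by rewrite expr0 divr1.
  by rewrite exprSr invfM mulrA -IH (sS k) mulrAC mulfV ?mul1r// pnatr_eq0.
(* 2^m t_0 = 1 lies in the kernel of c', so q lies in that of c. *)
pose q := 2 ^+ m * s 0%N.
have dbl k : c (2 ^+ k * s 0%N) = c' (2 ^+ k * t 0%N).
  elim: k => [|k IH]; first by rewrite !expr0 !mul1r (sP 0%N).2.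
  by rewrite exprS -!mulrA !mulr2n !mulrDl !mul1r (one_paramD oc) (one_paramD oc') IH.
have qint : q \is a Num.int.
  apply/kc; rewrite /q dbl; apply/kc'; rewrite /t addn0 -exprMn mulfV ?pnatr_eq0//.
  by rewrite expr1n.
exists q => //.
have d1 := one_param_derive oc'.
have d2 : is_derive (0 : R) 1 ((cmap a \o c) \o (fun r => q * r)) (q *: velocity A c 0).
  have dq : is_derive (0 : R) 1 (fun r : R => q * r) q.
    by apply: is_derive_eq; rewrite [q *: 1]mulr1.
  have := one_param_derive oc => -[dc E].
  have dfc : differentiable (cmap a \o c) (q * 0) by rewrite mulr0; apply/derivable1_diffP.
  apply: is_derive_eq (is_derive_comp dq dfc) _.
  by rewrite mulr0; have [_ ->] := is_derive_scale_direction q (one_param_derive oc).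
apply: (is_derive_unique_frequently d1 d2).
  by rewrite /= mulr0 (one_param0 oc) (one_param0 oc').
move=> e e0.
have [k ke] : exists k, t k < e.
  have := @cvg_expr R 2^-1; rewrite ger0_norm ?invr_ge0// invf_lt1 ?ltr1n// => /(_ isT).
  move=> /cvgrPdist_lt /(_ e e0)[k _ Hk]; exists k.
  have := Hk (m + k)%N; rewrite /= leq_addl => /(_ isT).
  by rewrite sub0r normrN ger0_norm // ltW // t0.
exists (t k); split; [by rewrite gt_eqF|by rewrite gtr0_norm|].
rewrite /= -(sP k).2; congr (cmap a (c _)).
rewrite sE /q /t exprD mulrA; congr (_ * _); last by rewrite exprVn.
by rewrite mulrAC -exprMn mulfV ?pnatr_eq0// expr1n mul1r.
Qed.

End Ranges.

(** * Lines in a torus *)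

(** At the identity, in the preferred chart, the transition map is the identity near the point, so
    [local_expr] is F itself. *)
Lemma finsler_continuous1 (R : realType) n (G : topGroupType) (A : atlas R n G)
    (F : G -> 'rV[R]_n -> R) : is_finsler A F -> continuous (F 1%g).
Proof.
move=> fF y; set a := chart_at A (1%g : G).
have Aa : charts A a by exact: chart_at_charts.
have a1 : cdom a 1%g by exact: chart_at_dom.
have aw := cmap_cimg a1.
have := finsler_continuous fF Aa (z := (cmap a 1%g, y)) aw.
move=> /continuous_slice; suff -> :
  (fun y => local_expr A F a (cmap a 1%g, y).1 (cmap a 1%g, y).2) = F 1%g by [].
apply/funext => v; rewrite /local_expr /= cmapK//; congr (F _ _).
apply: etrans (_ : 'D_v id (cmap a 1%g) = _); last by rewrite derive_id.
by apply: near_eq_derive; apply: filterS (near_cimg aw) => z az /=; rewrite cinvK.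
Qed.

(** By homogeneity F(u + i v) = i F(u/i + v), and by continuity the second factor eventually exceeds
    half of F(v), which is positive. *)
Lemma finsler_affine_unbounded (R : realType) n (G : topGroupType) (A : atlas R n G)
    (F : G -> 'rV[R]_n -> R) (u v : 'rV[R]_n) (M : R) : is_finsler A F -> v != 0 ->
  exists N, forall i, (N <= i)%N -> M < F 1%g (u + i%:R *: v).
Proof.
move=> fF v0; have Fv := finsler_gt0 fF 1%g v0.
have cvu : i.+1%:R^-1 *: u + v @[i --> \oo] --> v.
  rewrite -[X in _ --> X]add0r -[X in X + _](scale0r u).
  by apply: cvgD; [apply: cvgZr_tmp; exact: cvg_harmonic|exact: cvg_cst].
have cF : F 1%g (i.+1%:R^-1 *: u + v) @[i --> \oo] --> F 1%g v.
  exact: (@cvg_comp _ _ _ (fun i => i.+1%:R^-1 *: u + v) (F 1%g) _ _ _ cvu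
    (@finsler_continuous1 _ _ _ _ _ fF v)).
have Fv2 : F 1%g v / 2 < F 1%g v by rewrite ltr_pdivrMr// mulr_natr mulr2n ltrDl.
have [N _ HN] := cvgr_gt _ cF _ Fv2.
pose K := Num.truncn (`|M| / (F 1%g v / 2)).
exists (maxn N K).+1; case=> // i; rewrite ltnS geq_max => /andP[Ni Ki].
have i0 : 0 < i.+1%:R :> R by [].
have -> : u + i.+1%:R *: v = i.+1%:R *: (i.+1%:R^-1 *: u + v).
  by rewrite scalerDr scalerA mulfV ?scale1r// gt_eqF.
rewrite (finsler_homogeneous fF) ?ltW//.
have Mi : `|M| < i.+1%:R * (F 1%g v / 2).
  rewrite -ltr_pdivrMr ?divr_gt0//; apply: lt_le_trans (truncnS_gt _) _.
  by rewrite ler_nat ltnS.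
apply: le_lt_trans (ler_norm M) _; apply: lt_le_trans Mi _.
by apply: ler_wpM2l => //; apply/ltW/HN.
Qed.

Section Torus.
Variables (R : realType) (n : nat) (G : topGroupType) (A : atlas R n G).
Hypothesis lieG : is_lie_group A.
Local Notation a := (chart_at A (1%g : G)).
Variables (r : nat) (theta : 'rV[R]_r -> G).
Hypothesis smooth_theta : smooth_map A theta.
Hypothesis thetaD : forall x y, theta (x + y) = (theta x * theta y)%g.
Hypothesis theta_ker : forall x, theta x = 1%g <-> (forall i, x 0 i \is a Num.int).

Let theta0 : theta 0 = 1%g.
Proof. by apply/theta_ker => i; rewrite mxE. Qed.

Definition torus_line (w : 'rV[R]_r) (t : R) : G := theta (t *: w).

Let dtheta : differentiable (cmap a \o theta) 0.
Proof.
have [ct /(_ a (chart_at_charts A 1%g)) st] := smooth_theta.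
have oU : open (theta @^-1` cdom a).
  by apply: open_comp => [x _|]; [exact: ct|exact: cdom_open].
apply: (smooth_on_row_differentiable (fin_dim_rV R r) oU st).
by rewrite /= theta0; exact: chart_at_dom.
Qed.

Let torus_line_derive w : is_derive (0 : R) 1 (cmap a \o torus_line w) ('D_w (cmap a \o theta) 0).
Proof.
have E (h : R) : (cmap a \o theta) (h *: w + 0) = (cmap a \o torus_line w) (h *: 1 + 0).
  by rewrite /= /torus_line !addr0 [h *: 1]mulr1.
by apply: (is_derive_same_line _ E).1; apply/derivableP/diff_derivable.
Qed.

Lemma torus_line_one_param w : one_param A (torus_line w).
Proof.
split.
- by move=> s t; rewrite /torus_line scalerDl thetaD.
- move=> t; apply: (@continuous_comp _ _ _ (fun t : R => t *: w) theta).
    exact: scalel_continuous.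
  by have [ct _] := smooth_theta; exact: ct.
- by case: (torus_line_derive w).
Qed.

Lemma torus_line_velocity w : velocity A (torus_line w) 0 = 'D_w (cmap a \o theta) 0.
Proof.
rewrite /velocity derive1E (one_param0 (torus_line_one_param w)).
by case: (torus_line_derive w).
Qed.

Lemma torus_line_velocityD (u v : 'rV[R]_r) (k : R) :
  velocity A (torus_line (u + k *: v)) 0 =
  velocity A (torus_line u) 0 + k *: velocity A (torus_line v) 0.
Proof.
by rewrite !torus_line_velocity !deriveE// linearD linearZ.
Qed.

Lemma torus_line_velocity_neq0 (w : 'rV[R]_r) :
  (forall t, torus_line w t = 1%g -> t \is a Num.int) -> velocity A (torus_line w) 0 != 0.
Proof.
move=> kw; apply/eqP => Z0.
have [d /= d0 Hd] := one_param_velocity0 lieG (torus_line_one_param w) Z0.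
(* A time in the open interval from 0 to 1, hence not an integer, at which the line would already be
   at the identity. *)
pose t := Num.min d 1 / 2.
have t0 : 0 < t by rewrite divr_gt0// lt_min d0 ltr01.
have tm : t < Num.min d 1 by rewrite ltr_pdivrMr// mulr_natr mulr2n ltrDl lt_min d0 ltr01.
move: (tm); rewrite lt_min => /andP[td t1].
have /kw/int_norm_lt1 : torus_line w t = 1%g.
  by apply: Hd; rewrite /= sub0r normrN gtr0_norm.
by rewrite gtr0_norm// => /(_ t1) tE; rewrite tE ltxx in t0.
Qed.

Variables (i0 i1 : 'I_r).
Hypothesis i01 : i0 != i1.
Local Notation e0 := (delta_mx 0 i0 : 'rV[R]_r).
Local Notation e1 := (delta_mx 0 i1 : 'rV[R]_r).

(** The coordinate of index [i0] of [t (e0 + k e1)] is [t] itself, so the lattice condition forces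
    [t] to be an integer for every [k]. *)
Lemma torus_line_kernel (k : nat) t :
  torus_line (e0 + k%:R *: e1) t = 1%g <-> t \is a Num.int.
Proof.
rewrite /torus_line theta_ker; split=> [/(_ i0)|tint i].
  by rewrite !mxE !eqxx (negPf i01) andbF mulr0 addr0 mulr1.
rewrite !mxE eqxx /=; apply: rpredM => //; apply: rpredD; first exact: intr_nat.
by apply: rpredM; exact: intr_nat.
Qed.

Lemma torus_line_kernel1 t : torus_line e1 t = 1%g -> t \is a Num.int.
Proof. by move=> /theta_ker /(_ i1); rewrite !mxE !eqxx mulr1. Qed.

Variable F : G -> 'rV[R]_n -> R.
Hypothesis fF : is_finsler A F.
Hypothesis invF : left_invariant A F.
Hypothesis compactG : compact [set: G].

Lemma infinitely_many_geodesics :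
  infinite_set [set range c | c in is_homogeneous_geodesic A F].
Proof.
pose c (k : nat) := torus_line (e0 + k%:R *: e1).
have oc k : one_param A (c k) := torus_line_one_param _.
have c0 k : velocity A (c k) 0 != 0.
  by apply: torus_line_velocity_neq0 => t /torus_line_kernel.
have /choice[g gP] : forall k, exists g,
    is_homogeneous_geodesic A F (conj_curve g (c k)) /\
    F 1%g (velocity A (c k) 0) <= F 1%g (velocity A (conj_curve g (c k)) 0).
  by move=> k; exact: (exists_homogeneous_geodesic lieG fF invF compactG (oc k) (c0 k)).
pose c' k := conj_curve (g k) (c k).
have oc' k : one_param A (c' k) := one_param_conj lieG (g k) (oc k).
have kc' k t : c' k t = 1%g <-> t \is a Num.int.
  rewrite -(torus_line_kernel k) -/(c k) /c' /conj_curve; split=> [E|->].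
    by apply: (mulIg (g k)); apply: (mulgI (g k)^-1%g); rewrite mulgA E mul1g mulVg.
  by rewrite mulg1 mulVg.
have c'0 k : velocity A (c' k) 0 != 0.
  have := lt_le_trans (finsler_gt0 fF 1%g (c0 k)) (gP k).2.
  by apply: contraTneq => ->; rewrite (finsler0 fF) ltxx.
set S := [set range c | c in _] => finS.
(* With finitely many ranges the naturals would be a finite union of fibers, so it suffices that
   each fiber is finite. *)
pose fiber s := [set k | range (c' k) = s].
have ffin s : finite_set (fiber s).
  have [[k0 sk0]|nos] := pselect (fiber s !=set0); last first.
    suff -> : fiber s = set0 by exact: finite_set0.
    by apply/seteqP; split=> // k sk; apply: nos; exists k.
  (* F need not be reversible: the two velocities possible over one range may have different
     lengths. *)
  pose M := Num.max (F 1%g (velocity A (c' k0) 0)) (F 1%g (- velocity A (c' k0) 0)).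
  have v1 : velocity A (torus_line e1) 0 != 0.
    by apply: torus_line_velocity_neq0 => t /torus_line_kernel1.
  have [N HN] := finsler_affine_unbounded (velocity A (torus_line e0) 0) M fF v1.
  apply: sub_finite_set (finite_II N) => k sk /=; rewrite ltnNge; apply/negP => Nk.
  have := HN k Nk; rewrite -torus_line_velocityD -/(c k) ltNge => /negP; apply.
  apply: le_trans (gP k).2 _; rewrite -/(c' k).
  have rk : range (c' k0) = range (c' k) by rewrite sk0 sk.
  have [q qint Zq] := periodic_range_velocity lieG (oc' k0) (oc' k) (kc' k0) (kc' k) rk.
  have [q' q'int Zq'] := periodic_range_velocity lieG (oc' k) (oc' k0) (kc' k) (kc' k0) (esym rk).
  (* The multiples in the two directions are mutually inverse integers, which leaves 1 and -1. *)
  have qq : q' * q = 1.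
    have : (q' * q - 1) *: velocity A (c' k0) 0 = 0.
      by rewrite scalerBl scale1r -scalerA -Zq -Zq' subrr.
    move=> /eqP; rewrite scaler_eq0 (negPf (c'0 k0)) orbF subr_eq0 => /eqP//.
  rewrite Zq /M le_max.
  move: qint q'int qq => /intrP[z ->] /intrP[z' ->]; rewrite -intrM => /eqP.
  rewrite -[1]/(1%:~R) eqr_int => /eqP zz.
  have : z = 1 \/ z = -1.
    have := congr1 absz zz; rewrite abszM => /eqP; rewrite muln_eq1 => /andP[_ /eqP].
    by case: z {zz Zq} => [[|[|?]]|[|?]]// _; [left|right].
  by case=> ->; rewrite ?scale1r ?scaleN1r lexx ?orbT.
have : finite_set (\bigcup_(s in S) fiber s) by apply: bigcup_finite.
suff -> : \bigcup_(s in S) fiber s = [set: nat] by exact: infinite_nat.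
apply/seteqP; split=> // k _; exists (range (c' k)) => //.
by exists (c' k) => //; exact: (gP k).1.
Qed.

End Torus.

Theorem theorem3p7 (R : realType) (n : nat) (n_gt0 : (0 < n)%N)
    (G : topGroupType) (A : atlas R n G)
    (lieG : is_lie_group A)
    (compactG : compact [set: G]) (connectedG : connected [set: G])
    (F : G -> 'rV[R]_n -> R)
    (finslerF : is_finsler A F) (invF : left_invariant A F) :
  (exists c : R -> G, is_homogeneous_geodesic A F c) /\
  (semisimple A -> forall r : nat, has_rank A r -> (2 <= r)%N ->
     infinite_set [set range c | c in is_homogeneous_geodesic A F]).
Proof.
split.
  (* Any nonzero velocity serves; positive dimension supplies a basis vector. *)
  have [c oc Z] := exists_one_param (delta_mx 0 (Ordinal n_gt0)) lieG compactG.
  have [|g [gF _]] := exists_homogeneous_geodesic lieG finslerF invF compactG oc.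
    rewrite Z; apply/eqP => /rowP /(_ (Ordinal n_gt0)); rewrite !mxE !eqxx => /eqP.
    by rewrite oner_eq0.
  by exists (conj_curve g c).
move=> _ r [T [[theta [sm hom ker _]] _]] r2.
apply: (infinitely_many_geodesics lieG sm hom ker (i0 := Ordinal (ltnW r2)) (i1 := Ordinal r2)) => //.
Qed.
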